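(* (Weak de Finetti for quasi-Borel spaces.) Let $(X,M_X)$ be a quasi-Borel space. If $(\alpha,\mu)$ is an exchangeable probability measure on $X^\omega$, then there exists a probability measure $(\beta,\nu)$ on the quasi-Borel space $P(X)$ (so $[\beta,\nu]\in P(P(X))$) such that for all $n\ge1$, the element $([\beta,\nu]\gg\!=\mathrm{iid}_n)$ of $P(X^n)$ equals $P((-)_{1\dots n})([\alpha,\mu])$ when both are considered as measures on the product measurable space $(X^n,\bigotimes_{i=1}^n\Sigma_{M_X})$. Here $(-)_{1\dots n}\colon X^\omega\to X^n$ is $(x)_{1\dots n}=(x_1,\dots,x_n)$.
   Context: A quasi-Borel space is a set $X$ together with a set $M_X$ of functions $\mathbb{R}\to X$ such that: (i) $\alpha\circ f\in M_X$ whenever $\alpha\in M_X$ and $f\colon\mathbb{R}\to\mathbb{R}$ is (Borel) measurable; (ii) every constant function $\mathbb{R}\to X$ is in $M_X$; (iii) if $\mathbb{R}=\biguplus_{i\in\mathbb{N}}S_i$ with each $S_i$ Borel and $\alpha_i\in M_X$ for each $i$, then $\beta\in M_X$, where $\beta(r)=\alpha_i(r)$ for $r\in S_i$. A morphism $(X,M_X)\to(Y,M_Y)$ is a function $f\colon X\to Y$ with $f\circ\alpha\in M_Y$ for all $\alpha\in M_X$. The product $\prod_iX_i$ of quasi-Borel spaces is the product set with $M_{\prod_iX_i}=\{f\colon\mathbb{R}\to\prod_iX_i\mid\forall i.\ \pi_i\circ f\in M_{X_i}\}$; $X^n=\prod_{i=1}^nX$ and $X^\omega=\prod_{i=1}^\infty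 X$. $\Sigma_{M_X}=\{U\subseteq X\mid\forall\alpha\in M_X.\ \alpha^{-1}(U)\text{ is Borel}\}$, a $\sigma$-algebra on $X$; one always has $\bigotimes_{i=1}^n\Sigma_{M_X}\subseteq\Sigma_{M_{X^n}}$. $G(\mathbb{R})$ is the set of Borel probability measures on $\mathbb{R}$ with the $\sigma$-algebra generated by the sets $\{\mu\mid\mu(U)<r\}$ for $U$ Borel and $r\in[0,1]$, and $(\mu\gg\!=_Gg)(U)=\int g(r)(U)\,\mathrm{d}\mu(r)$ for measurable $g\colon\mathbb{R}\to G(\mathbb{R})$. A probability measure on $(X,M_X)$ is a pair $(\alpha,\mu)$ with $\alpha\in M_X$ and $\mu\in G(\mathbb{R})$. Write $(\alpha,\mu)\sim(\alpha',\mu')$ if $\alpha_*\mu=\alpha'_*\mu'$ as measures on $(X,\Sigma_{M_X})$, and $[\alpha,\mu]$ for the equivalence class. An element $[\alpha,\mu]$ is considered as a measure via the push-forward $\alpha_*\mu$ (restricted to the sub-$\sigma$-algebra in question). $P(X)$ is the quasi-Borel space of probability measures on $(X,M_X)$ modulo $\sim$, with $M_{P(X)}$ the set of $\beta\colon\mathbb{R}\to P(X)$ for which there exist $\alpha\in M_X$ and a measurable $g\colon\mathbb{R}\to G(\mathbb{R})$ with $\beta(r)=[\alpha,g(r)]$ for all $r$. For a morphism $f\colon X\to Y$, $P(f)([\alpha,\mu])=[f\circ\alpha,\mu]$. $P$ is a monad with bind: for a morphism $f\colon X\to P(Y)$ and $[\alpha,\mu]\in P(X)$, choose measurable $g\colon\mathbb{R}\to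 G(\mathbb{R})$ and $\beta\in M_Y$ with $(f\circ\alpha)(r)=[\beta,g(r)]$ for all $r$, and set $([\alpha,\mu]\gg\!=f)=[\beta,\mu\gg\!=_Gg]$. For $n\ge1$, $\mathrm{iid}_n\colon P(X)\to P(X^n)$ is the morphism $\mathrm{iid}_n([\beta,\nu])=\big[(\prod_{i=1}^n\beta)\circ\iota_n,\ (\iota_n^{-1})_*\bigotimes_{i=1}^n\nu\big]$, where $\iota_n\colon\mathbb{R}\to\prod_{i=1}^n\mathbb{R}$ is a measurable isomorphism, $\prod_{i=1}^n\beta\colon\mathbb{R}^n\to X^n$ applies $\beta$ componentwise, and $\bigotimes_{i=1}^n\nu$ is the $n$-fold product measure. A probability measure $(\alpha,\mu)$ on $X^\omega$ is exchangeable if for all permutations $\pi$ of the positive integers, $[\alpha,\mu]=[\alpha_\pi,\mu]$, where $\alpha_\pi(r)_i=\alpha(r)_{\pi(i)}$ for all $r\in\mathbb{R}$ and $i\ge1$. *)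

(* Defs.v *)
From HB Require Import structures.
From mathcomp Require Import all_boot all_order all_algebra generic_quotient.
From mathcomp Require Import ring lra.
From mathcomp Require Import all_classical all_reals all_analysis.
From mathcomp Require Import measurable_realfun giry.
Set Implicit Arguments.
Unset Strict Implicit.
Unset Printing Implicit Defensive.
Import Order.TTheory GRing.Theory Num.Theory.
Import numFieldNormedType.Exports.
Local Open Scope classical_set_scope.
Local Open Scope ring_scope.

(* Throughout, R : realType is the real line, with its canonical (Borel)
   measurable structure. *)

Record borel_iso d1 d2 (T1 : measurableType d1) (T2 : measurableType d2) :=
  BorelIso {
    iso_to : T1 -> T2;
    iso_from : T2 -> T1;
    iso_to_measurable : measurable_fun setT iso_to;
    iso_from_measurable : measurable_fun setT iso_from;
    iso_toK : cancel iso_to iso_from;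
    iso_fromK : cancel iso_from iso_to }.

Section schroeder_bernstein.
Context d1 d2 (T1 : measurableType d1) (T2 : measurableType d2).
Variables (f : T1 -> T2) (f' : T2 -> T1) (g : T2 -> T1) (g' : T1 -> T2).
Hypotheses (mf : measurable_fun setT f) (mf' : measurable_fun setT f').
Hypotheses (mg : measurable_fun setT g) (mg' : measurable_fun setT g').
Hypotheses (fK : cancel f f') (gK : cancel g g').
Hypothesis mrf : measurable [set t | f (f' t) = t].
Hypothesis mrg : measurable [set t | g (g' t) = t].

Let back (C : set T1) : set T1 :=
  [set t | g (g' t) = t] `&` g' @^-1` ([set t | f (f' t) = t] `&` f' @^-1` C).
Let Cn n := iter n back (~` [set t | g (g' t) = t]).
Let C := \bigcup_n Cn n.
Let D := [set t | f (f' t) = t] `&` f' @^-1` C.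

Let mpre d d' (T : measurableType d) (T' : measurableType d') (h : T -> T') A :
  measurable_fun setT h -> measurable A -> measurable (h @^-1` A).
Proof. by move=> mh mA; rewrite -[X in measurable X]setTI; exact: mh. Qed.

Let mC : measurable C.
Proof.
apply: bigcup_measurable => n _; elim: n => [|n IH] /=; first exact: measurableC.
by apply: measurableI => //; apply: mpre => //; apply: measurableI => //; exact: mpre.
Qed.

Let mD : measurable D.
Proof. by apply: measurableI => //; exact: mpre. Qed.

Let glue d d' (T : measurableType d) (T' : measurableType d') (u v : T -> T')
    (E : set T) : measurable E -> measurable_fun setT u -> measurable_fun setT v ->
  measurable_fun setT (fun t => if t \in E then u t else v t).
Proof.
move=> mE mu mv; apply: measurable_fun_ifT => //.
by apply: (measurable_fun_bool true); rewrite setTI preimage_mem_true.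
Qed.

Lemma borel_schroeder_bernstein : inhabited (borel_iso T1 T2).
Proof.
have h1 : cancel (fun a => if a \in C then f a else g' a)
                 (fun b => if b \in D then f' b else g b).
  move=> a; case: (boolP (a \in C)) => /=.
    rewrite inE => Ca; rewrite ifT; first exact: fK.
    by rewrite inE; split; rewrite /= fK.
  rewrite notin_setE => Ca.
  have ra : g (g' a) = a by apply: contrapT => ra; apply: Ca; exists 0%N.
  rewrite ifF//; apply/negP; rewrite inE => -[/= rf [n _ Cna]].
  by apply: Ca; exists n.+1.
have h2 : cancel (fun b => if b \in D then f' b else g b)
                 (fun a => if a \in C then f a else g' a).
  move=> b; case: (boolP (b \in D)) => /=.
    by rewrite inE => -[/= rb Cb]; rewrite ifT// inE.
  rewrite notin_setE => Db; rewrite ifF ?gK//; apply/negP; rewrite inE.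
  move=> [[|n] _ /=]; first by rewrite gK.
  rewrite /back /= gK => -[_ [rb Cb]]; apply: Db; split => //=.
  by exists n.
by constructor; apply: (BorelIso _ _ h1 h2); exact: glue.
Qed.

End schroeder_bernstein.

(* A Borel embedding of R^n into R with a Borel retraction: a tuple is coded by
   the ternary digits 0 / 2 of the truth values of (q < t_i), for q rational and
   i < n.  It yields the Borel isomorphisms between R and R^n, and it also
   serves to glue sequences of random elements in prob_qbs_glue. *)
Section encoding.
Context {R : realType} (n : nat).

Let tern_ (b : nat -> bool) : R^nat := fun k => 2 * (b k)%:R / 3 ^+ k.+1.

Let tern (b : nat -> bool) : R := limn (series (tern_ b)).

Let tern_le1 b k : series (tern_ b) k <= 1 - 3 ^- k.
Proof.
elim: k => [|k IH]; first by rewrite /series/= big_geq// expr0 invr1 subrr.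
rewrite seriesSr (le_trans (lerD IH (_ : _ <= 2 / 3 ^+ k.+1)))//.
  by rewrite ler_pM2r ?invr_gt0 ?exprn_gt0//; case: (b k); rewrite ?mulr1 ?mulr0.
rewrite exprS; have : (3 : R) ^+ k != 0 by rewrite expf_neq0.
by move=> h; rewrite le_eqVlt; apply/orP; left; apply/eqP; field.
Qed.

Let cvg_tern b : cvgn (series (tern_ b)).
Proof.
apply: nondecreasing_is_cvgn.
  by apply: nondecreasing_series => k _ _; rewrite divr_ge0 ?mulr_ge0 ?exprn_ge0.
exists 1 => _ [k _ <-]; apply: (le_trans (tern_le1 b k)).
by rewrite gerBl invr_ge0 exprn_ge0.
Qed.

Let tern01 b : 0 <= tern b <= 1.
Proof.
apply/andP; split.
  apply: limr_ge; first exact: cvg_tern.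
  apply: nearW => k; apply: sumr_ge0 => i _.
  by rewrite divr_ge0 ?mulr_ge0 ?exprn_ge0.
apply: limr_le; first exact: cvg_tern.
by apply: nearW => k; apply: (le_trans (tern_le1 b k)); rewrite gerBl invr_ge0 exprn_ge0.
Qed.

Let ternS b : tern b = (2 * (b 0%N)%:R + tern (fun k => b k.+1)) / 3.
Proof.
apply: cvg_lim => //; rewrite -(cvg_shiftS _).
rewrite (_ : [sequence _]_n = (fun k =>
  (2 * (b 0%N)%:R + series (tern_ (fun k => b k.+1)) k) / 3)).
  apply: cvgMl; apply: cvgD; first exact: cvg_cst.
  exact: cvg_tern.
apply/funext => k; rewrite /series/= big_nat_recl// mulrDl /tern_ expr1; congr (_ + _).
rewrite mulr_suml; apply: eq_bigr => i _; rewrite [in LHS]exprS invfM.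
by rewrite -!mulrA [3^-1 * _]mulrC.
Qed.

Let step (r : R) : R := 3 * r - 2 * (2^-1 <= r)%R%:R.

Let digit (r : R) (k : nat) : bool := 2^-1 <= iter k step r.

Let digitS r k : digit r k.+1 = digit (step r) k.
Proof. by rewrite /digit iterSr. Qed.

Let digit_tern b k : digit (tern b) k = b k.
Proof.
have digit0 c : (2^-1 <= tern c) = c 0%N.
  rewrite ternS; have /andP[] := tern01 (fun k => c k.+1).
  move: (tern _) => t t0 t1; case: (c 0%N) => /=; last by apply/negbTE; lra.
  by lra.
elim: k b => [|k IH] b; first exact: digit0.
rewrite digitS /step digit0 -(IH (fun k => b k.+1)); congr (digit _ k).
by rewrite [in LHS]ternS; field.
Qed.

Let cut (t : n.-tuple R) (m : nat) : bool :=
  if unpickle m is Some (i, q) then ratr q < tnth t i else false.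

Definition tuple_enc (t : n.-tuple R) : R := tern (cut t).

Definition tuple_dec (r : R) : n.-tuple R :=
  [tuple fine (ereal_sup (range (fun m =>
     if unpickle m is Some q then
       if digit r (pickle (i, q)) then (ratr (q : rat))%:E else -oo%E
     else -oo%E))) | i < n].

Lemma tuple_encK : cancel tuple_enc tuple_dec.
Proof.
move=> t; apply: eq_from_tnth => i; rewrite tnth_mktuple /tuple_enc.
rewrite (_ : ereal_sup _ = (tnth t i)%:E)//; apply/eqP; rewrite eq_le.
apply/andP; split.
  apply: ge_ereal_sup => _ [m _ <-]; case: (unpickle m) => [q|]; last exact: leNye.
  rewrite digit_tern /cut pickleK; case: ifPn => [/ltW|_]; last exact: leNye.
  by rewrite lee_fin.
apply/lee_subgt0Pr => e e0.
have [q] : exists q : rat, ratr q \in `]tnth t i - e, tnth t i[%R.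
  by apply: rat_in_itvoo; rewrite gtrBl.
rewrite in_itv/= => /andP[q1 q2].
apply: (@le_trans _ _ (ratr q)%:E); first by rewrite -EFinB lee_fin ltW.
apply: ereal_sup_ubound; exists (pickle q) => //.
by rewrite pickleK digit_tern /cut pickleK q2.
Qed.

Lemma measurable_tuple_enc : measurable_fun setT tuple_enc.
Proof.
apply: (@measurable_fun_cvg _ _ _ _ (fun N t => series (tern_ (cut t)) N)).
  2: by move=> t _; exact: cvg_tern.
move=> N; apply: measurable_sum => k.
apply: measurable_funM => //; apply: measurable_funM => //.
rewrite /cut; case: (unpickle k) => [[i q]|]; last exact: measurable_cst.
rewrite (_ : (fun _ => _) = (fun t => if ratr q < tnth t i then 1 else 0)); last first.
  by apply/funext => t; case: (_ < _).
apply: measurable_fun_ifT => //; apply: measurable_fun_ltr => //.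
exact: measurable_tnth.
Qed.

Lemma measurable_tuple_dec : measurable_fun setT tuple_dec.
Proof.
apply/measurable_fun_tnthP => i; rewrite [X in measurable_fun _ X](_ : _ = fun r =>
    fine (esups (fun m => if unpickle m is Some q then
       if digit r (pickle (i, q)) then (ratr (q : rat))%:E else -oo%E
     else -oo%E) 0)); last first.
  apply/funext => r; rewrite /= tnth_mktuple; congr fine; congr ereal_sup.
  apply/seteqP; split => [_ [m _ <-]|_ [m _ <-]]; by exists m.
apply: measurableT_comp; first exact: fine_measurable.
apply: measurable_fun_esups => m; case: (unpickle m) => [q|]; last exact: measurable_cst.
apply: measurable_fun_ifT => //; apply: measurable_fun_ler => //.
elim: (pickle _) => [|k IH] /=; first exact: measurable_id.
apply: measurable_funB; first by apply: measurable_funM.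
apply: measurable_funM => //.
rewrite (_ : (fun _ => _) = (fun t => if 2^-1 <= iter k step t then 1 else 0)); last first.
  by apply/funext => t; case: (_ <= _).
by apply: measurable_fun_ifT => //; apply: measurable_fun_ler.
Qed.

Lemma borel_iso_tuple : (0 < n)%N -> inhabited (borel_iso R (n.-tuple R)).
Proof.
move=> n0; pose i0 := Ordinal n0.
apply: (@borel_schroeder_bernstein _ _ _ _ (fun r => [tuple r | i < n])
  (fun t => tnth t i0) tuple_enc tuple_dec).
- by apply/measurable_fun_tnthP => i; rewrite [X in measurable_fun _ X](_ : _ = id)//;
    apply/funext => r /=; rewrite tnth_mktuple.
- exact: measurable_tnth.
- exact: measurable_tuple_enc.
- exact: measurable_tuple_dec.
- by move=> r; rewrite tnth_mktuple.
- exact: tuple_encK.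
- rewrite (_ : [set _ | _] = \bigcap_(i in [set: 'I_n])
      [set t : n.-tuple R | tnth t i0 == tnth t i]); last first.
    apply/seteqP; split => t /= h.
      by move=> i _; rewrite /= -{2}h tnth_mktuple.
    by apply: eq_from_tnth => i; rewrite tnth_mktuple; apply/eqP; exact: (h i I).
  apply: fin_bigcap_measurable => // i _.
  rewrite -[X in measurable X]setTI.
  have := @measurable_fun_eqr _ (n.-tuple R) R setT (fun t => tnth t i0) (fun t => tnth t i)
    (@measurable_tnth _ _ _ _) (@measurable_tnth _ _ _ _).
  by move=> /(_ measurableT [set true]); exact.
- rewrite (_ : [set _ | _] = [set t : R | tuple_enc (tuple_dec t) == t]); last first.
    by apply/seteqP; split => t /= /eqP.
  rewrite -[X in measurable X]setTI.
  have := @measurable_fun_eqr _ R R setT (tuple_enc \o tuple_dec) id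
    (measurableT_comp measurable_tuple_enc measurable_tuple_dec) (@measurable_id _ _ _).
  by move=> /(_ measurableT [set true]); exact.
Qed.

End encoding.

Section probability_map.
Context d1 d2 (T1 : measurableType d1) (T2 : measurableType d2) (R : realType).
Variables (f : T1 -> T2) (mf : measurable_fun setT f) (mu : probability T1 R).

HB.instance Definition _ := isMeasurableFun.Build _ _ _ _ f mf.

Definition probability_map : probability T2 R := distribution mu f.

End probability_map.

Section probability_bind.
Context d1 d2 (T1 : measurableType d1) (T2 : measurableType d2) (R : realType).
Variables (mu : probability T1 R) (g : T1 -> probability T2 R).
Hypothesis mg : measurable_fun setT (g : T1 -> pprobability T2 R).

Let bind (U : set T2) : \bar R := (\int[mu]_r g r U)%E.

Let mgU U : measurable U -> measurable_fun setT (fun r => g r U).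
Proof. by move=> mU; exact: (measurable_kernel (kprobability mg) U). Qed.

Let bind0 : bind set0 = 0%E.
Proof. by rewrite /bind integral0_eq. Qed.

Let bind_ge0 U : (0 <= bind U)%E.
Proof. by apply: integral_ge0. Qed.

Let bind_sigma_additive : semi_sigma_additive bind.
Proof.
move=> F mF tF mUF.
rewrite [X in _ --> X](_ : _ = (\int[mu]_r \sum_(0 <= k <oo) g r (F k))%E); last first.
  apply: eq_integral => r _; apply/esym/cvg_lim => //.
  exact: measure_semi_sigma_additive.
rewrite [X in X @ _](_ : _ = (fun n => \int[mu]_r (\sum_(0 <= k < n) g r (F k))%E)%E); last first.
  by apply/funext => n; rewrite ge0_integral_sum// => k; exact: mgU.
apply: cvg_monotone_convergence => //.
- by move=> n; apply: emeasurable_sum => k; exact: mgU.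
- by move=> n r _; exact: sume_ge0.
- by move=> r _ m n mn; exact: ereal_nondecreasing_series.
Qed.

HB.instance Definition _ := isMeasure.Build _ _ _ bind
  bind0 bind_ge0 bind_sigma_additive.

Let bindT : bind setT = 1%E.
Proof.
rewrite /bind (eq_integral (cst 1%E)); last by move=> r _; exact: probability_setT.
by rewrite integral_cst// mul1e; exact: probability_setT.
Qed.

HB.instance Definition _ := Measure_isProbability.Build _ _ _ bind bindT.

Definition probability_bind : probability T2 R := bind.

End probability_bind.

Lemma measurable_pprobability d1 d2 (T1 : measurableType d1)
    (T2 : measurableType d2) (R : realType) (g : T1 -> probability T2 R) :
  measurable_fun setT (g : T1 -> pprobability T2 R) <->
  forall U, measurable U -> measurable_fun setT (fun r => g r U).
Proof.
split=> [mg U mU|mg]; first exact: (measurable_kernel (kprobability mg) U).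
apply: (measurability (@pset _ _ _ : set (set (pprobability _ R)))) => //.
by move=> _ -[_ [r r01] [U mU <-]] <-; apply: emeasurable_fun_infty_o => //; exact: mg.
Qed.

(* The n-fold product measure; iid_probability_box characterizes it. *)
Section iid_probability.
Context d (T : measurableType d) (R : realType).

Definition cons_tuple n (x : T * n.-tuple T) : n.+1.-tuple T :=
  [tuple of x.1 :: x.2].

Lemma measurable_cons_tuple n : measurable_fun setT (@cons_tuple n).
Proof. exact: measurable_cons. Qed.

Fixpoint iid_probability (nu : probability T R) n : probability (n.-tuple T) R :=
  if n is n'.+1 then
    probability_map (@measurable_cons_tuple n')
      (nu \x iid_probability nu n')%E
  else \d_([tuple]).

Lemma iid_probability_box (nu : probability T R) n (A : 'I_n -> set T) :
  (forall i, measurable (A i)) ->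
  iid_probability nu n [set t | forall i, A i (tnth t i)] =
  (\prod_(i < n) nu (A i))%E.
Proof.
elim: n A => [|n IH] A mA.
  by rewrite big_ord0 /= diracE mem_set// => -[].
rewrite big_ord_recl -IH// /= /probability_map /pushforward/=.
rewrite -product_measure1E//.
  congr (_ _); apply/seteqP; split => [[x t] /= h|[x t] /= [h0 h] i].
    split; first by have := h ord0; rewrite tnth0.
    by move=> i; have := h (lift ord0 i); rewrite tnthS.
  by case: (unliftP ord0 i) => [j|] ->; rewrite ?tnthS ?tnth0.
rewrite (_ : [set _ | _] = \bigcap_(i in [set: 'I_n])
  ((fun t : n.-tuple T => tnth t i) @^-1` A (lift ord0 i))); last first.
  by apply/seteqP; split => [t h i _|t h i]; [exact: h|exact: (h i I)].
apply: fin_bigcap_measurable => // i _; rewrite -[X in measurable X]setTI.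
exact: measurable_tnth.
Qed.

Lemma measurable_iid_probability d' (T' : measurableType d')
    (g : T' -> probability T R) n :
  measurable_fun setT (g : T' -> pprobability T R) ->
  measurable_fun setT
    ((fun r => iid_probability (g r) n) : T' -> pprobability (n.-tuple T) R).
Proof.
move=> mg; elim: n => [|n IH]; first exact: measurable_cst.
apply/measurable_pprobability => U mU.
have mto d1 (T1 : measurableType d1) (h : T' -> probability T1 R) :
    measurable_fun setT (h : T' -> pprobability T1 R) ->
    measurable_fun setT ((fun r => h r : subprobability T1 R) : T' -> giry T1 R).
  by move=> /measurable_pprobability mh; apply: measurable_giry_codensity.
have mU' : measurable (@cons_tuple n @^-1` U).
  by rewrite -[X in measurable X]setTI; exact: measurable_cons_tuple.
apply: (measurableT_comp (measurable_giry_ev mU')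
  (measurableT_comp measurable_giry_prod (measurable_fun_pair (mto _ _ _ mg) (mto _ _ _ IH)))).
Qed.

End iid_probability.

Record qbs (R : realType) := Qbs {
  qbs_sort :> Type;
  qbs_rv : set (R -> qbs_sort);
  qbs_rv_comp : forall alpha (f : R -> R),
    qbs_rv alpha -> measurable_fun setT f -> qbs_rv (alpha \o f);
  qbs_rv_cst : forall x, qbs_rv (fun=> x);
  qbs_rv_glue : forall (S : nat -> set R) (alpha : nat -> R -> qbs_sort) beta,
    (forall i, measurable (S i)) -> trivIset setT S -> \bigcup_i S i = setT ->
    (forall i, qbs_rv (alpha i)) ->
    (forall i r, S i r -> beta r = alpha i r) -> qbs_rv beta }.

Arguments qbs_rv {R} q.

Record qbs_morph (R : realType) (X Y : qbs R) := QbsMorph {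
  qbs_fun :> X -> Y;
  qbs_morphP : forall alpha, qbs_rv X alpha -> qbs_rv Y (qbs_fun \o alpha) }.

Section product.
Context {R : realType} (I : Type) (X : I -> qbs R).

Definition qbs_prod_rv : set (R -> forall i, X i) :=
  [set f | forall i, qbs_rv (X i) (fun r => f r i)].

Lemma qbs_prod_comp alpha (f : R -> R) :
  qbs_prod_rv alpha -> measurable_fun setT f -> qbs_prod_rv (alpha \o f).
Proof. by move=> ha mf i; exact: (qbs_rv_comp (ha i) mf). Qed.

Lemma qbs_prod_cst x : qbs_prod_rv (fun=> x).
Proof. by move=> i; exact: qbs_rv_cst. Qed.

Lemma qbs_prod_glue (S : nat -> set R) (alpha : nat -> R -> forall i, X i) beta :
  (forall i, measurable (S i)) -> trivIset setT S -> \bigcup_i S i = setT ->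
  (forall i, qbs_prod_rv (alpha i)) ->
  (forall i r, S i r -> beta r = alpha i r) -> qbs_prod_rv beta.
Proof.
move=> mS tS cS ha hb i; apply: (qbs_rv_glue mS tS cS (fun k => ha k i)).
by move=> k r Skr; rewrite (hb k).
Qed.

Definition qbs_prod : qbs R := Qbs qbs_prod_comp qbs_prod_cst qbs_prod_glue.

End product.

Definition qbs_pow (R : realType) (X : qbs R) (n : nat) : qbs R :=
  qbs_prod (fun _ : 'I_n => X).

(* The coordinates of X^omega, numbered 1, 2, ... on paper, are indexed from 0. *)
Definition qbs_omega (R : realType) (X : qbs R) : qbs R :=
  qbs_prod (fun _ : nat => X).

Definition qbs_sigma (R : realType) (X : qbs R) : set_system X :=
  [set U | forall alpha, qbs_rv X alpha -> measurable (alpha @^-1` U)].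

(* The product sigma-algebra on X^n of the sigma-algebras qbs_sigma X. *)
Definition pow_sigma (R : realType) (X : qbs R) n : set_system (qbs_pow X n) :=
  <<s \bigcup_(i in [set: 'I_n])
        preimage_set_system setT (fun x : qbs_pow X n => x i) (@qbs_sigma R X) >>.
Arguments pow_sigma {R} X n _.

Lemma qbs_sigma_algebra (R : realType) (X : qbs R) :
  sigma_algebra setT (@qbs_sigma R X).
Proof.
split=> [alpha _|U mU alpha ha|U mU alpha ha].
- by rewrite preimage_set0.
- by rewrite setTD preimage_setC; apply: measurableC; exact: mU.
- by rewrite preimage_bigcup; apply: bigcup_measurable => i _; exact: mU.
Qed.

Lemma pow_sigma_sub (R : realType) (X : qbs R) n :
  pow_sigma X n `<=` @qbs_sigma R (qbs_pow X n).
Proof.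
apply: smallest_sub; first exact: qbs_sigma_algebra.
move=> _ [i _ [U mU <-]] alpha ha; rewrite setTI.
by apply: (mU (fun r => alpha r i)); exact: ha.
Qed.

Record qbs_prob (R : realType) (X : qbs R) := QbsProb {
  prob_rv : R -> X;
  prob_rvP : qbs_rv X prob_rv;
  prob_law : probability R R }.

(* The push-forward of the law along the random element; it is only meaningful
   on sets of qbs_sigma X, since an element of probability R R is a function on
   all sets, unconstrained on the non-Borel ones. *)
Definition prob_meas (R : realType) (X : qbs R) (p : qbs_prob X) (U : set X) :
    \bar R :=
  prob_law p (prob_rv p @^-1` U).

HB.instance Definition _ (R : realType) (X : qbs R) := gen_eqMixin (qbs_prob X).
HB.instance Definition _ (R : realType) (X : qbs R) :=
  gen_choiceMixin (qbs_prob X).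

Section prob_quotient.
Context {R : realType} (X : qbs R).

Definition prob_equiv (p q : qbs_prob X) : bool :=
  `[< forall U, qbs_sigma U -> prob_meas p U = prob_meas q U >].

Lemma prob_equiv_refl : reflexive prob_equiv.
Proof. by move=> p; apply/asboolP. Qed.

Lemma prob_equiv_sym : symmetric prob_equiv.
Proof. by move=> p q; apply/asboolP/asboolP => h U mU; rewrite h. Qed.

Lemma prob_equiv_trans : transitive prob_equiv.
Proof.
by move=> q p r /asboolP pq /asboolP qr; apply/asboolP => U mU; rewrite pq ?qr.
Qed.

Canonical prob_equiv_rel :=
  EquivRel prob_equiv prob_equiv_refl prob_equiv_sym prob_equiv_trans.

Definition prob_quot := {eq_quot prob_equiv}%qT.

Definition prob_class (p : qbs_prob X) : prob_quot := (\pi_prob_quot p)%qT.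

(* By class_measE the choice of representative is irrelevant on qbs_sigma X. *)
Definition class_meas (c : prob_quot) : set X -> \bar R := prob_meas (repr c).

Lemma prob_classP p q :
  prob_class p = prob_class q <->
  forall U, qbs_sigma U -> prob_meas p U = prob_meas q U.
Proof.
split=> [/eqmodP /asboolP //|h]; apply/eqmodP; exact/asboolP.
Qed.

Lemma prob_classK c : prob_class (repr c) = c.
Proof. exact: reprK. Qed.

Lemma class_measE p U : qbs_sigma U -> class_meas (prob_class p) U = prob_meas p U.
Proof. by move: U; apply/prob_classP; exact: prob_classK. Qed.

End prob_quotient.

Section prob_qbs.
Context {R : realType} (X : qbs R).

Definition prob_qbs_rv : set (R -> prob_quot X) := [set b |
  exists alpha (ha : qbs_rv X alpha) (g : R -> probability R R),
    measurable_fun setT (g : R -> pprobability R R) /\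
    forall r, b r = prob_class (QbsProb ha (g r))].

Lemma prob_qbs_comp b (f : R -> R) : prob_qbs_rv b -> measurable_fun setT f -> prob_qbs_rv (b \o f).
Proof.
move=> [alpha [ha [g [mg bE]]]] mf; exists alpha, ha, (g \o f).
by split => [|r /=]; [exact: measurableT_comp|exact: bE].
Qed.

Lemma prob_qbs_cst c : prob_qbs_rv (fun=> c).
Proof.
exists (prob_rv (repr c)), (prob_rvP (repr c)), (fun=> prob_law (repr c)).
split=> [|r]; first exact: measurable_cst.
by rewrite -[LHS]prob_classK; congr prob_class; case: (repr c).
Qed.

Lemma prob_qbs_glue (S : nat -> set R) (b_ : nat -> R -> prob_quot X) b :
  (forall i, measurable (S i)) -> trivIset setT S -> \bigcup_i S i = setT ->
  (forall i, prob_qbs_rv (b_ i)) ->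
  (forall i r, S i r -> b r = b_ i r) -> prob_qbs_rv b.
Proof.
move=> mS tS cS hb bE.
have /choice [a_ ha_] : forall i, exists alpha, exists (ha : qbs_rv X alpha)
    (g : R -> probability R R),
    measurable_fun setT (g : R -> pprobability R R) /\
    forall r, b_ i r = prob_class (QbsProb ha (g r)) by move=> i; exact: hb.
have {hb} ra i : qbs_rv X (a_ i) by have [] := ha_ i.
have /choice [g_ hg_] : forall i, exists g : R -> probability R R,
    measurable_fun setT (g : R -> pprobability R R) /\
    forall r, b_ i r = prob_class (QbsProb (ra i) (g r)).
  move=> i; have [ha [g [mg gE]]] := ha_ i; exists g; split => // r.
  by rewrite gE (Prop_irrelevance ha (ra i)).
have mcoord i : measurable_fun setT (fun s : R => tnth (tuple_dec 2 s) i).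
  exact: (measurableT_comp (@measurable_tnth _ _ _ i) (@measurable_tuple_dec R 2)).
pose coord (i : 'I_2) (s : R) := tnth (tuple_dec 2 s) i.
pose emb (k : nat) (x : R) : R := tuple_enc [tuple k%:R; x].
have memb k : measurable_fun setT (emb k).
  apply: (measurableT_comp (@measurable_tuple_enc R 2)).
  apply/measurable_fun_tnthP => i; case: (unliftP ord0 i) => [j|] ->.
    rewrite [X in measurable_fun _ X](_ : _ = id)//; apply/funext => x /=.
    by rewrite (ord1 j).
  rewrite [X in measurable_fun _ X](_ : _ = cst k%:R); first exact: measurable_cst.
  by apply/funext => x.
have idx_ex r : exists i, S i r by have : setT r by []; rewrite -cS => -[i _ Sir]; exists i.
pose idx r := sval (cid (idx_ex r)).
have idxP r : S (idx r) r by rewrite /idx; case: cid.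
have mle k : measurable [set s | (Num.trunc (coord ord0 s) <= k)%N].
  rewrite (_ : [set _ | _] = setT `&` (fun s => coord ord0 s < k.+1%:R) @^-1` [set true]).
    have : measurable_fun setT (fun s => coord ord0 s < k.+1%:R).
      by apply: measurable_fun_ltr; [exact: mcoord|exact: measurable_cst].
    by move=> /(_ measurableT [set true]); exact.
  by rewrite setTI; apply/seteqP; split => s /=; rewrite truncn_le_nat.
pose alpha s := a_ (Num.trunc (coord ord0 s)) (coord ord_max s).
have ralpha : qbs_rv X alpha.
  apply: (@qbs_rv_glue _ X (fun k => [set s | Num.trunc (coord ord0 s) = k])
    (fun k => a_ k \o coord ord_max)).
  - move=> [|k].
      rewrite (_ : [set _ | _] = [set s | (Num.trunc (coord ord0 s) <= 0)%N])//.
      by apply/seteqP; split => s /=; rewrite leqn0 => /eqP.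
    rewrite (_ : [set _ | _] = [set s | (Num.trunc (coord ord0 s) <= k.+1)%N] `\`
        [set s | (Num.trunc (coord ord0 s) <= k)%N]); first exact: measurableD.
    apply/seteqP; split => s /=; first by move=> ->; split => //; rewrite ltnn.
    by move=> [h1 /negP]; rewrite -ltnNge => h2; apply/eqP; rewrite eqn_leq h1.
  - apply/trivIsetP => i j _ _ ij; apply/seteqP; split => // s [/= iE jE].
    by move: ij; rewrite -iE -jE eqxx.
  - by apply/seteqP; split => // s _; exists (Num.trunc (coord ord0 s)).
  - by move=> k; apply: qbs_rv_comp; [exact: ra|exact: mcoord].
  - by move=> k s /= <-.
exists alpha, ralpha, (fun r => probability_map (memb (idx r)) (g_ (idx r) r)).
split.
  apply/measurable_pprobability => U mU; rewrite -cS; apply/measurable_fun_bigcup => // i.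
  apply: (@eq_measurable_fun _ _ _ _ _ (fun r => g_ i r (emb i @^-1` U))).
    move=> r; rewrite inE => Sir; rewrite /probability_map /= /distribution /pushforward.
    suff -> : idx r = i by [].
    by apply: tS => //; exists r; split => //; exact: idxP.
  apply: measurable_funTS; have [/measurable_pprobability mg _] := hg_ i.
  by apply: mg; rewrite -[X in measurable X]setTI; exact: memb.
move=> r; rewrite (bE (idx r))//; have [_ ->] := hg_ (idx r).
apply/prob_classP => U mU; rewrite /prob_meas /= /distribution /pushforward.
congr (_ _); apply/seteqP; split => x; rewrite /= /alpha /coord /emb tuple_encK;
  by rewrite (tnth_nth 0) /= (tnth_nth 0) /= natrK.
Qed.

Definition prob_qbs : qbs R := Qbs prob_qbs_comp prob_qbs_cst prob_qbs_glue.

End prob_qbs.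

Section prob_integral.
Context {R : realType} (X : qbs R).

Lemma eq_prob_integral (p q : qbs_prob X) (F : X -> \bar R) :
  (forall x, (0 <= F x)%E) ->
  (forall alpha, qbs_rv X alpha -> measurable_fun setT (F \o alpha)) ->
  prob_class p = prob_class q ->
  (\int[prob_law p]_r F (prob_rv p r) = \int[prob_law q]_r F (prob_rv q r))%E.
Proof.
move=> F0 mF /prob_classP pq.
have push (u : qbs_prob X) : (\int[prob_law u]_r F (prob_rv u r) =
    \int[probability_map (mF _ (prob_rvP u)) (prob_law u)]_y `|y|)%E.
  rewrite (@ge0_integral_pushforward _ _ _ _ _ _ (mF _ (prob_rvP u)))//=.
  by apply: eq_integral => r _; rewrite gee0_abs.
pose m (u : qbs_prob X) : {measure set (\bar R) -> \bar R} :=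
  probability_map (mF _ (prob_rvP u)) (prob_law u).
rewrite !push; apply: (@eq_measure_integral _ _ _ setT (m q) (m p)) => B mB _.
apply: (pq (F @^-1` B)) => alpha ha; rewrite -comp_preimage -[X in measurable X]setTI.
exact: (mF _ ha).
Qed.

End prob_integral.

Section functor.
Context {R : realType} (X Y : qbs R) (f : qbs_morph X Y).

Definition prob_map (p : qbs_prob X) : qbs_prob Y :=
  QbsProb (qbs_morphP f (prob_rvP p)) (prob_law p).

Definition class_map (c : prob_qbs X) : prob_qbs Y :=
  prob_class (prob_map (repr c)).

Lemma class_mapE p : class_map (prob_class p) = prob_class (prob_map p).
Proof.
have /prob_classP pE := prob_classK (prob_class p).
apply/prob_classP => U mU; apply: (pE (f @^-1` U)) => alpha ha.
by apply: (mU (f \o alpha)); exact: qbs_morphP.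
Qed.

End functor.

Section bind.
Context {R : realType} (X Y : qbs R).

(* All choices of p, beta and g are allowed; is_bind_uniq shows that the
   resulting class does not depend on them. *)
Definition is_bind (c : prob_qbs X) (f : qbs_morph X (prob_qbs Y))
    (d : prob_qbs Y) : Prop :=
  exists (p : qbs_prob X) (beta : R -> Y) (hbeta : qbs_rv Y beta)
    (g : R -> probability R R)
    (mg : measurable_fun setT (g : R -> pprobability R R)),
  [/\ c = prob_class p,
      forall r, f (prob_rv p r) = prob_class (QbsProb hbeta (g r)) &
      d = prob_class (QbsProb hbeta (probability_bind (prob_law p) mg))].

Lemma is_bind_ex c f : exists d, is_bind c f d.
Proof.
have [beta [hbeta [g [mg gE]]]] := qbs_morphP f (prob_rvP (repr c)).
exists (prob_class (QbsProb hbeta (probability_bind (prob_law (repr c)) mg))).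
exists (repr c), beta, hbeta, g, mg; split => //.
by rewrite prob_classK.
Qed.

Lemma is_bind_uniq c f d1 d2 : is_bind c f d1 -> is_bind c f d2 -> d1 = d2.
Proof.
move=> [p [b [hb [g [mg [cp fE ->]]]]]] [p' [b' [hb' [g' [mg' [cp' fE' ->]]]]]].
apply/prob_classP => U mU; rewrite /prob_meas/=.
pose F x := class_meas (f x) U.
have FE q a (ha : qbs_rv Y a) (h : R -> probability R R) r :
    f (prob_rv q r) = prob_class (QbsProb ha (h r)) ->
    h r (a @^-1` U) = F (prob_rv q r).
  by move=> fh; rewrite /F fh class_measE.
transitivity (\int[prob_law p]_r F (prob_rv p r))%E.
  by apply: eq_integral => r _; exact: FE.
transitivity (\int[prob_law p']_r F (prob_rv p' r))%E; last first.
  by apply: eq_integral => r _; apply/esym; exact: FE.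
apply: eq_prob_integral; last by rewrite -cp -cp'.
  by move=> x; exact: measure_ge0.
move=> alpha ha; have [a [ra [h [mh hE]]]] := qbs_morphP f ha.
apply: (eq_measurable_fun (fun r => h r (a @^-1` U))).
  by move=> r _; have /= fE'' := hE r; rewrite /F /= fE'' class_measE.
by move/measurable_pprobability : mh; apply; exact: mU.
Qed.

Definition class_bind (c : prob_qbs X) (f : qbs_morph X (prob_qbs Y)) :
    prob_qbs Y :=
  sval (cid (is_bind_ex c f)).

Lemma class_bindP c f d : is_bind c f d -> class_bind c f = d.
Proof. by apply: is_bind_uniq; rewrite /class_bind; case: cid. Qed.

End bind.

(* iota_n; by prob_iid_measE the class of prob_iid does not depend on it. *)
Definition tuple_iso (R : realType) (n : nat) (n_gt0 : (0 < n)%N) :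
    borel_iso R (n.-tuple R) :=
  inhabited_witness (borel_iso_tuple n_gt0).

Section iid.
Context {R : realType} (X : qbs R) (n : nat) (n_gt0 : (0 < n)%N).
Let iota := tuple_iso R n_gt0.

Lemma iid_rvP (beta : R -> X) : qbs_rv X beta ->
  qbs_rv (qbs_pow X n) (fun r i => beta (tnth (iso_to iota r) i)).
Proof.
move=> hbeta i /=; apply: (qbs_rv_comp hbeta).
exact: (measurableT_comp (measurable_tnth i) (iso_to_measurable iota)).
Qed.

Definition prob_iid (p : qbs_prob X) : qbs_prob (qbs_pow X n) :=
  QbsProb (iid_rvP (prob_rvP p))
    (probability_map (iso_from_measurable iota)
      (iid_probability (prob_law p) n)).

Lemma prob_iid_measE p U : prob_meas (prob_iid p) U =
  iid_probability (prob_law p) n [set t | U (fun i => prob_rv p (tnth t i))].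
Proof.
rewrite /prob_meas /= /distribution /pushforward; congr (_ _).
by apply/seteqP; split => t /=; rewrite iso_fromK.
Qed.

End iid.

Section iid_morphism.
Context {R : realType} (X : qbs R).

Lemma measurable_tuple_preimage (Y : qbs R) n (phi : n.-tuple R -> Y) U :
  qbs_rv Y (phi \o tuple_dec n) -> qbs_sigma U -> measurable (phi @^-1` U).
Proof.
move=> hphi mU; rewrite (_ : phi @^-1` U =
    @tuple_enc R n @^-1` ((phi \o tuple_dec n) @^-1` U)).
  by rewrite -[X in measurable X]setTI; apply: measurable_tuple_enc => //; exact: mU.
by apply/seteqP; split => t /=; rewrite tuple_encK.
Qed.

Lemma measurable_tnth_dec n i : measurable_fun setT (fun r : R => tnth (tuple_dec n r) i).
Proof. exact: (measurableT_comp (measurable_tnth i) (@measurable_tuple_dec R n)). Qed.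

Let consf n (x : X) (y : qbs_pow X n) : qbs_pow X n.+1 :=
  fun i => if unlift ord0 i is Some j then y j else x.

Lemma iid_probability_equiv (p q : qbs_prob X) n (U : set (qbs_pow X n)) :
  prob_class p = prob_class q -> qbs_sigma U ->
  iid_probability (prob_law p) n [set t | U (fun i => prob_rv p (tnth t i))] =
  iid_probability (prob_law q) n [set t | U (fun i => prob_rv q (tnth t i))].
Proof.
move=> pq; elim: n U => [|n IH] U mU.
  congr (_ _); apply/seteqP; split => t /=; congr (U _); apply/funext => -[] //.
pose ev (u : qbs_prob X) m (t : m.-tuple R) : qbs_pow X m := fun i => prob_rv u (tnth t i).
pose F x := iid_probability (prob_law q) n [set t | U (consf x (ev q n t))].
have sec x : qbs_sigma [set y : qbs_pow X n | U (consf x y)].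
  move=> alpha ha; apply: (mU (fun r => consf x (alpha r))) => i.
  by rewrite /consf; case: unlift => [j|]; [exact: ha|exact: qbs_rv_cst].
have step u : prob_class u = prob_class q ->
    (forall V : set (qbs_pow X n), qbs_sigma V ->
      iid_probability (prob_law u) n [set t | V (ev u n t)] =
      iid_probability (prob_law q) n [set t | V (ev q n t)]) ->
    iid_probability (prob_law u) n.+1 [set t | U (ev u n.+1 t)] =
    (\int[prob_law u]_r F (prob_rv u r))%E.
  move=> uq uV; rewrite /= /distribution /pushforward /product_measure1.
  apply: eq_integral => r _; rewrite /F -(uV _ (sec (prob_rv u r))) /=.
  congr (_ _); apply/seteqP; split => t /=; rewrite /xsection/= inE/=;
    rewrite (_ : ev u n.+1 _ = consf (prob_rv u r) (ev u n t))//;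
    apply/funext => i; rewrite /ev /consf; case: unliftP => [j|] ->;
    by rewrite ?tnthS ?tnth0.
rewrite [LHS](step p)// [RHS](step q)//.
apply: eq_prob_integral => // gamma hg.
pose phi (t : n.+1.-tuple R) : qbs_pow X n.+1 :=
  consf (gamma (tnth t ord0)) (fun j => prob_rv q (tnth t (lift ord0 j))).
have mphi : measurable (phi @^-1` U).
  apply: measurable_tuple_preimage => // i; rewrite /phi /consf /=.
  case: unlift => [j|].
    exact: (qbs_rv_comp (prob_rvP q) (measurable_tnth_dec (lift ord0 j))).
  exact: (qbs_rv_comp hg (measurable_tnth_dec ord0)).
have mcons : measurable (@cons_tuple _ R n @^-1` (phi @^-1` U)).
  by rewrite -[X in measurable X]setTI; exact: measurable_cons_tuple.
rewrite (_ : F \o gamma = iid_probability (prob_law q) n \o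
    xsection (@cons_tuple _ R n @^-1` (phi @^-1` U))).
  exact: (measurable_fun_xsection (iid_probability (prob_law q) n) mcons).
apply/funext => r.
have phiE t : phi (cons_tuple (r, t)) = consf (gamma r) (ev q n t).
  rewrite /phi tnth0; congr consf; apply/funext => j; by rewrite /ev tnthS.
rewrite /= (_ : xsection _ _ = [set t | U (consf (gamma r) (ev q n t))])//.
by apply/seteqP; split => t /=; rewrite /xsection/= inE/= phiE.
Qed.

Context (n : nat) (n_gt0 : (0 < n)%N).

Definition class_iid (c : prob_qbs X) : prob_qbs (qbs_pow X n) :=
  prob_class (prob_iid n_gt0 (repr c)).

Lemma class_iidE p : class_iid (prob_class p) = prob_class (prob_iid n_gt0 p).
Proof.
apply/prob_classP => U mU; rewrite !prob_iid_measE.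
by apply: iid_probability_equiv => //; exact: prob_classK.
Qed.

Lemma class_iid_morph b : qbs_rv (prob_qbs X) b ->
  qbs_rv (prob_qbs (qbs_pow X n)) (class_iid \o b).
Proof.
move=> [alpha [ha [g [mg bE]]]].
exists (fun r i => alpha (tnth (iso_to (tuple_iso R n_gt0) r) i)), (iid_rvP n_gt0 ha).
exists (fun r => probability_map (iso_from_measurable (tuple_iso R n_gt0))
  (iid_probability (g r) n)); split => [|r].
  apply/measurable_pprobability => U mU.
  have /measurable_pprobability := measurable_iid_probability (n := n) mg; apply.
  by rewrite -[X in measurable X]setTI; exact: iso_from_measurable.
by rewrite /= bE class_iidE.
Qed.

Definition iid : qbs_morph (prob_qbs X) (prob_qbs (qbs_pow X n)) :=
  QbsMorph class_iid_morph.

End iid_morphism.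

Section exchangeable.
Context {R : realType} (X : qbs R).

Lemma qbs_prefix_morph n alpha : qbs_rv (qbs_omega X) alpha ->
  qbs_rv (qbs_pow X n) ((fun (x : qbs_omega X) (i : 'I_n) => x i) \o alpha).
Proof. by move=> ha i; exact: ha. Qed.

Definition qbs_prefix n : qbs_morph (qbs_omega X) (qbs_pow X n) :=
  QbsMorph (@qbs_prefix_morph n).

Lemma permute_rvP (pi : nat -> nat) alpha : qbs_rv (qbs_omega X) alpha ->
  qbs_rv (qbs_omega X) (fun r i => alpha r (pi i)).
Proof. by move=> ha i; exact: ha. Qed.

Definition permute_prob (pi : nat -> nat) (p : qbs_prob (qbs_omega X)) :
    qbs_prob (qbs_omega X) :=
  QbsProb (permute_rvP pi (prob_rvP p)) (prob_law p).

Definition exchangeable (p : qbs_prob (qbs_omega X)) : Prop :=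
  forall pi : nat -> nat, bijective pi ->
    prob_class p = prob_class (permute_prob pi p).

End exchangeable.

(* Main.v *)
(* The laws of the coordinates live on the standard Borel space R, so a regular
   conditional law k of r given the future (alpha(r)_1, alpha(r)_2, ...) exists;
   it is a kernel from X^omega to R, and g(r) = k(alpha(r)),
   beta(r) = [alpha_0, g(r)], nu = mu.  Let P be the law of alpha, theta the
   shift, and h_A(x) = k(x)(alpha_0^-1 A), so that h_A o theta is the conditional
   probability of x_0 \in A given theta(x).  Since P is invariant under deletion
   of a coordinate, conditioning on theta(theta(x)) instead of theta(x) yields
   the same function, and comparing L^2 norms gives h_A o theta = h_A almost
   everywhere.  Peeling off one coordinate at a time then replaces
   the indicators of x_i \in A_i by h_(A_i), and boxes determine the measures on
   the product sigma-algebra. *)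
Require Import Defs.
From HB Require Import structures.
From mathcomp Require Import all_boot all_order all_algebra.
From mathcomp Require Import ring zify.
From mathcomp Require Import all_classical all_reals all_analysis.
From mathcomp Require Import measurable_realfun giry.
Set Implicit Arguments.
Unset Strict Implicit.
Unset Printing Implicit Defensive.
Import Order.TTheory GRing.Theory Num.Theory.
Import numFieldNormedType.Exports.
Local Open Scope classical_set_scope.
Local Open Scope ring_scope.

(** * Measure-theoretic tools: uniqueness, comparison of integrals, densities *)

Lemma measurable_preimage d d' (S : measurableType d) (T : measurableType d')
    (f : S -> T) (A : set T) :
  measurable_fun setT f -> measurable A -> measurable (f @^-1` A).
Proof. by move=> mf mA; rewrite -[X in measurable X]setTI; exact: mf. Qed.

(** Dynkin's pi-lambda theorem: finiteness and equal total mass make the sets of agreement stable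
    under complement. *)
Lemma finite_measure_unique d (T : measurableType d) (R : realType)
    (G : set_system T) (m1 m2 : {finite_measure set T -> \bar R}) :
  measurable = <<s G >> -> setI_closed G -> m1 setT = m2 setT ->
  (forall A, G A -> m1 A = m2 A) -> forall A, measurable A -> m1 A = m2 A.
Proof.
move=> mG GI m12T m12 A; rewrite mG; move: A.
apply: dynkin_induction => // [S mS mSE|F mF tF FE].
  by rewrite -setTD !measureD//= ?setTI ?m12T ?mSE//; exact: fin_num_fun_lty.
by rewrite !measure_bigcup//; apply: eq_eseriesr => n _; exact: FE.
Qed.

Section integral_comparison.
Local Open Scope ereal_scope.
Context d (T : measurableType d) (R : realType).
Variable mu : {finite_measure set T -> \bar R}.

(** On every measurable part of [C], where [g < f], the hypothesis and monotonicity force equal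
    integrals. Hence [f = g] almost everywhere on [C], that is, [C] is null. *)
Lemma ae_le_integral (f g : T -> \bar R) :
  mu.-integrable setT f -> mu.-integrable setT g ->
  (forall E, measurable E ->
    \int[mu]_(x in E) f x <= \int[mu]_(x in E) g x) ->
  {ae mu, forall x, f x <= g x}.
Proof.
move=> fi gi fg.
have mf := measurable_int _ fi; have mg := measurable_int _ gi.
pose C := [set x | g x < f x].
have mC : measurable C by rewrite -[C]setTI; exact: measurable_lte.
have [N [mN N0 subN]] : ae_eq mu C f g.
  apply: integral_ae_eq => //.
  - exact: (integrableS measurableT).
  - exact: (measurable_funS measurableT).
  - move=> E EC mE; apply/eqP; rewrite eq_le fg//=.
    apply: le_integral => //; do ?exact: (integrableS measurableT).
    by move=> x /[!inE] /EC /ltW.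
exists N; split => // x /= /negP; rewrite -ltNge => gf; apply: subN => /=.
by move=> /(_ gf) fgE; move: gf; rewrite fgE ltxx.
Qed.

(** Change of variables holds for the chosen Radon-Nikodym derivative, and [h] agrees with it almost
    everywhere because both have the same integrals over measurable sets. *)
Lemma ge0_integral_density (nu : {finite_measure set T -> \bar R})
    (h phi : T -> \bar R) :
  measurable_fun setT h -> (forall x, 0 <= h x) ->
  (forall C, measurable C -> nu C = \int[mu]_(x in C) h x) ->
  measurable_fun setT phi -> (forall x, 0 <= phi x) ->
  \int[nu]_x phi x = \int[mu]_x (phi x * h x).
Proof.
move=> mh h0 nuE mphi phi0.
have numu : nu `<< mu.
  apply/null_content_dominatesP => C mC C0; rewrite nuE//.
  by apply: null_set_integral => //; exact: (measurable_funS measurableT).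
rewrite -(Radon_Nikodym_SigmaFinite.change_of_variables numu)//.
set f := Radon_Nikodym_SigmaFinite.f _ _.
have fi : mu.-integrable setT f by exact: Radon_Nikodym_SigmaFinite.f_integrable.
have f0 x : 0 <= f x by exact: Radon_Nikodym_SigmaFinite.f_ge0.
have mf := measurable_int _ fi.
apply: ge0_ae_eq_integral => //.
- exact: emeasurable_funM.
- exact: emeasurable_funM.
- by move=> x _; rewrite mule_ge0.
- by move=> x _; rewrite mule_ge0.
have : ae_eq mu setT f h.
  apply: integral_ae_eq => // E _ mE.
  by rewrite -Radon_Nikodym_SigmaFinite.f_integral// nuE.
by apply: filterS => x /= + Tx => /(_ Tx) ->.
Qed.

End integral_comparison.

Section restricted_law.
Local Open Scope ereal_scope.
Context d d' (S : measurableType d) (T : measurableType d') (R : realType).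
Variables (mu : {finite_measure set S -> \bar R}) (Y : S -> T) (D : set S).
Hypotheses (mY : measurable_fun setT Y) (mD : measurable D).

(* The unused proofs are arguments so that the measure instances can be inferred. *)
Definition restricted_law of measurable_fun setT Y & measurable D :
  set T -> \bar R := fun C => mu (D `&` Y @^-1` C).

Local Notation nu := (restricted_law mY mD).

Let nu0 : nu set0 = 0.
Proof. by rewrite /restricted_law preimage_set0 setI0 measure0. Qed.

Let nu_ge0 C : 0 <= nu C.
Proof. exact: measure_ge0. Qed.

Let nu_sigma_additive : semi_sigma_additive nu.
Proof.
move=> F mF tF mUF; rewrite /restricted_law preimage_bigcup setI_bigcupr.
apply: measure_semi_sigma_additive.
- by move=> n; apply: measurableI => //; exact: measurable_preimage.
- apply/trivIsetP => i j _ _ ij; rewrite setIACA setIid -preimage_setI.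
  by move/trivIsetP : tF => /(_ _ _ _ _ ij) ->//; rewrite preimage_set0 setI0.
- rewrite -setI_bigcupr -preimage_bigcup; apply: measurableI => //.
  exact: measurable_preimage.
Qed.

HB.instance Definition _ := isMeasure.Build _ _ _ nu nu0 nu_ge0 nu_sigma_additive.

Let nu_fin : fin_num_fun nu.
Proof.
move=> C mC; apply: fin_num_measure; apply: measurableI => //.
exact: measurable_preimage.
Qed.

HB.instance Definition _ := @Measure_isFinite.Build _ _ _ nu nu_fin.

End restricted_law.

(** Both sides are the integral of [phi] against [restricted_law mu mY mD], which has density [h]
    with respect to [P]. *)
Lemma ge0_integral_law_density d d' (S : measurableType d) (T : measurableType d')
    (R : realType) (mu : {finite_measure set S -> \bar R})
    (P : {finite_measure set T -> \bar R}) (Y : S -> T) (D : set S)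
    (h phi : T -> \bar R) :
  measurable_fun setT Y -> measurable D ->
  measurable_fun setT h -> (forall x, 0 <= h x)%E ->
  (forall C, measurable C -> mu (D `&` Y @^-1` C) = \int[P]_(x in C) h x)%E ->
  measurable_fun setT phi -> (forall x, 0 <= phi x)%E ->
  (\int[mu]_(s in D) phi (Y s) = \int[P]_x (phi x * h x))%E.
Proof.
move=> mY mD mh h0 hE mphi phi0.
have mphiY : measurable_fun setT (phi \o Y) by exact: measurableT_comp.
rewrite -(@ge0_integral_density _ _ _ P (restricted_law mu mY mD))//.
(* For the identity map, [restricted_law] is the restriction of [mu] to [D], with density the
   indicator of [D]; its push-forward along [Y] is the measure above. *)
transitivity (\int[restricted_law mu (@measurable_id _ _ setT) mD]_s phi (Y s))%E.
  rewrite (@ge0_integral_density _ _ _ mu _ (fun s => (\1_D s)%:E))//=.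
  - rewrite integral_mkcond; apply: eq_integral => s _.
    by rewrite patchE indicE; case: (s \in D); rewrite ?mule1 ?mule0.
  - by apply/measurable_EFinP; exact: measurable_indic.
  - by move=> C mC; rewrite integral_indic.
rewrite -(@ge0_integral_pushforward _ _ _ _ _ _ mY _ setT phi)//.
Qed.

(** * Regular conditional laws of a real random variable *)

Section disintegration.
Local Open Scope ereal_scope.
Context d d' (S : measurableType d) (T : measurableType d') (R : realType).
Variables (mu : probability S R) (Y : S -> T) (Z : S -> R).
Hypotheses (mY : measurable_fun setT Y) (mZ : measurable_fun setT Z).

Let P : probability T R := probability_map mY mu.
Let measurable_idR : measurable_fun setT (idfun : measurableTypeR R -> R).
Proof. by move=> _ B mB; rewrite setTI. Qed.

(* The library puts the uniform distribution on another copy of the Borel line. *)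
Let lambda : probability R R :=
  probability_map measurable_idR (uniform_prob (@ltr01 R)).

Let lambda_lt (a : \bar R) : 0 <= a -> a <= 1 -> lambda [set u | u%:E < a] = a.
Proof.
case: a => [a| |]//; rewrite !lee_fin => a0 a1.
rewrite /lambda/= /distribution /pushforward/= /uniform_prob integral_uniform_pdf.
rewrite (_ : _ `&` _ = `[0%R, a[%classic); last first.
  apply/seteqP; split => u /=; rewrite !in_itv/= lte_fin.
    by move=> [-> /andP[->]].
  by move=> /andP[-> ua]; rewrite ua (le_trans (ltW ua)).
rewrite (eq_integral (cst 1)); last first.
  move=> u; rewrite inE/= in_itv/= => /andP[u0 ua].
  by rewrite /uniform_pdf u0 (le_trans (ltW ua) a1) subr0 invr1.
rewrite integral_cst//= mul1e.
have /= -> := lebesgue_measure_itv `[0%R, a[.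
by rewrite lte_fin; case: ltgtP a0 => // [_ _|<-]; rewrite ?sube0.
Qed.

(** A version of the conditional probability of [Z < x] given [Y = t]. It is chosen separately for
    each [x], so relations between different [x] hold only almost everywhere. *)
Let density_ex (x : R) : exists f : T -> \bar R,
  [/\ forall t, 0 <= f t, P.-integrable setT f &
   forall C, measurable C ->
     mu (Z @^-1` `]-oo, x[ `&` Y @^-1` C) = \int[P]_(t in C) f t].
Proof.
have mZx : measurable (Z @^-1` `]-oo, x[) by exact: measurable_preimage.
have : restricted_law mu mY mZx `<< P.
  apply/null_content_dominatesP => C mC C0.
  have mYC : measurable (Y @^-1` C) by exact: measurable_preimage.
  by apply: (@subset_measure0 _ _ _ mu _ (Y @^-1` C)) => //; exact: measurableI.
by move=> /radon_nikodym_sigma_finite[f [f0 _ fi fE]]; exists f.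
Qed.

Let f_ x := sval (cid (density_ex x)).

Let f_ge0 x t : 0 <= f_ x t.
Proof. by have [f0 _ _] := svalP (cid (density_ex x)); exact: f0. Qed.

Let f_int x : P.-integrable setT (f_ x).
Proof. by have [] := svalP (cid (density_ex x)). Qed.

Let f_E x C : measurable C ->
  mu (Z @^-1` `]-oo, x[ `&` Y @^-1` C) = \int[P]_(t in C) f_ x t.
Proof. by have [_ _] := svalP (cid (density_ex x)); exact. Qed.

Let mf_ x : measurable_fun setT (f_ x).
Proof. exact: measurable_int (f_int x). Qed.

Let mZY x C : measurable C -> measurable (Z @^-1` `]-oo, x[ `&` Y @^-1` C).
Proof. by move=> mC; apply: measurableI; exact: measurable_preimage. Qed.

Let f_le1 x : {ae P, forall t, f_ x t <= 1}.
Proof.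
apply: (@ae_le_integral _ _ _ P _ (cst 1)) => //.
  by apply: finite_measure_integrable_cst.
move=> C mC; rewrite -f_E// integral_cst// mul1e.
apply: le_measure; rewrite ?inE; [exact: mZY|exact: measurable_preimage|].
exact: subIsetr.
Qed.

Let f_homo x y : (x <= y)%R -> {ae P, forall t, f_ x t <= f_ y t}.
Proof.
move=> xy; apply: ae_le_integral => // C mC; rewrite -!f_E//.
apply: le_measure; rewrite ?inE; [exact: mZY|exact: mZY|].
apply: setSI => s /=; rewrite !in_itv/= => /lt_le_trans; exact.
Qed.

Let TR : measurableType _ := (T * R)%type.

(* The generalized inverse of the conditional distribution function. *)
Let V (p : TR) : \bar R :=
  ereal_inf [set (ratr q)%:E | q in [set q : rat | p.2%:E < f_ (ratr q) p.1]].

(** Only rational levels enter [V], so this union is countable and gives the measurability of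
    [V]. *)
Let V_lt (x : R) : V @^-1` `]-oo, x%:E[ =
  \bigcup_(q in [set q : rat | ratr q < x]%R)
    [set p | p.2%:E < f_ (ratr q) p.1].
Proof.
apply/seteqP; split => [p /=|p [q /= qx pq]].
  rewrite in_itv/= => /ereal_inf_lt[_ [q pq <-]].
  by rewrite lte_fin => qx; exists q.
rewrite in_itv/=; apply: (@le_lt_trans _ _ (ratr q)%:E); last by rewrite lte_fin.
by apply: ereal_inf_lbound; exists q.
Qed.

Let mV : measurable_fun [set: TR] V.
Proof.
apply: (measurability _ (ErealGenInftyO.measurableE R)) => _ /= -[_ [x ->] <-].
rewrite setTI V_lt bigcup_mkcond; apply: bigcupT_measurable_rat => q.
case: ifP => // _.
rewrite -[X in measurable X]setTI; apply: measurable_lte => //.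
  by apply/measurable_EFinP; exact: measurable_snd.
by apply: measurableT_comp => //; exact: measurable_fst.
Qed.

(** [fine] sends infinite values of [V] to 0; by [levelE] below they occur with probability 0 under
    the product of [P] and [lambda]. *)
Let W (p : TR) : R := fine (V p).

Let mW : measurable_fun [set: TR] W.
Proof. exact: measurableT_comp. Qed.

Let mW1 t : measurable_fun setT (fun u => W (t, u)).
Proof. by apply: measurableT_comp => //; exact: pair1_measurable. Qed.

Let xsectionE (A T1 T2 : Type) (F : T1 * T2 -> A) (B : set A) t :
  xsection (F @^-1` B) t = (fun u => F (t, u)) @^-1` B.
Proof. by apply/seteqP; split => u; rewrite /xsection/= inE. Qed.

Let mV_lt x : measurable (V @^-1` `]-oo, x%:E[).
Proof. by apply: (measurable_preimage mV); apply: emeasurable_itv. Qed.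

Let mxsection_lt x t : measurable (xsection (V @^-1` `]-oo, x%:E[) t).
Proof. by apply: measurable_xsection; apply: mV_lt. Qed.

Let level_lt x : {ae P, forall t,
  lambda (xsection (V @^-1` `]-oo, x%:E[) t) <= f_ x t}.
Proof.
(* Countably many null sets are discarded at once. The minimum with [x] makes the inequality true
   for every index; indices coding no rational stand for 0. *)
have mono n : {ae P, forall t,
    f_ (Num.min (ratr (odflt 0%R (unpickle n : option rat))) x) t <= f_ x t}.
  by apply: f_homo; rewrite ge_min lexx orbT.
have := ae_foralln mono; apply: filterS2 (f_le1 x) => t fx1 ft.
rewrite -(lambda_lt (f_ge0 x t) fx1); apply: le_measure; rewrite ?inE.
- exact: mxsection_lt.
- by rewrite -[X in measurable X]setTI; apply: measurable_lte.
rewrite V_lt => u; rewrite /xsection/= inE => -[q /= qx uq].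
apply: (lt_le_trans uq); have := ft (pickle q).
by rewrite pickleK/= min_l// ltW.
Qed.

Let level_gt x y : (x < y)%R -> {ae P, forall t,
  f_ x t <= lambda (xsection (V @^-1` `]-oo, y%:E[) t)}.
Proof.
move=> /rat_in_itvoo[q]; rewrite in_itv/= => /andP[xq qy].
apply: filterS2 (f_le1 (ratr q)) (f_homo (ltW xq)) => t fq1 fxq.
apply: (le_trans fxq).
rewrite -(lambda_lt (f_ge0 (ratr q) t) fq1); apply: le_measure; rewrite ?inE.
- by rewrite -[X in measurable X]setTI; apply: measurable_lte.
- exact: mxsection_lt.
by rewrite V_lt => u /= uq; rewrite /xsection/= inE; exists q.
Qed.

Let mlevel B : measurable B ->
  measurable_fun setT (fun t => lambda (xsection (V @^-1` B) t)).
Proof.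
by move=> mB; apply: measurable_fun_xsection; exact: measurable_preimage.
Qed.

Let level_itv x C : measurable C ->
  \int[P]_(t in C) lambda (xsection (V @^-1` `]-oo, x%:E[) t) =
  mu (Y @^-1` C `&` (EFin \o Z) @^-1` `]-oo, x%:E[).
Proof.
move=> mC; have ZxE r : Y @^-1` C `&` (EFin \o Z) @^-1` `]-oo, r%:E[ =
    Z @^-1` `]-oo, r[ `&` Y @^-1` C.
  by rewrite setIC; apply/seteqP; split => s /=; rewrite !in_itv/= lte_fin.
rewrite ZxE; apply/eqP; rewrite eq_le; apply/andP; split.
  rewrite f_E//; apply: ae_ge0_le_integral => //.
  - by apply: measurable_funTS; apply: mlevel; apply: emeasurable_itv.
  - exact: measurable_funTS.
  - by apply: filterS (level_lt x) => t + _.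
(* [level_gt] needs a gap between two levels, so the event [Z < x] is exhausted from below by levels
   [x - 1/(n+1)]. *)
pose E (n : nat) := Z @^-1` `]-oo, (x - n.+1%:R^-1)%R[ `&` Y @^-1` C.
have Ebig : \bigcup_n E n = Z @^-1` `]-oo, x[ `&` Y @^-1` C.
  rewrite -setI_bigcupl; congr (_ `&` _); apply/seteqP.
  split => [s [n _] /=|s /=]; rewrite !in_itv/=.
    by move=> /lt_le_trans; apply; rewrite gerBl.
  move=> /ltr_add_invr[n nx]; exists n => //=.
  by rewrite in_itv/= ltrBrDr.
rewrite -Ebig.
have cE : mu (E n) @[n --> \oo] --> mu (\bigcup_n E n).
  apply: nondecreasing_cvg_mu => //.
  - by move=> n; exact: mZY.
  - by apply: bigcupT_measurable => n; exact: mZY.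
  - move=> m n mn; apply/subsetPset; apply: setSI => s /=; rewrite !in_itv/=.
    move=> /lt_le_trans; apply; rewrite lerB// lef_pV2 ?posrE// ler_nat//.
rewrite -(cvg_lim _ cE)//; apply: lime_le.
  by apply/cvg_ex; eexists; exact: cE.
apply: nearW => n; rewrite /E f_E//; apply: ae_ge0_le_integral => //.
- exact: measurable_funTS.
- by apply: measurable_funTS; apply: mlevel; apply: emeasurable_itv.
- have /level_gt : (x - n.+1%:R^-1 < x)%R by rewrite gtrBl.
  by apply: filterS => t + _.
Qed.

(** As functions of [B], both sides are finite measures: the left one is the law of [V] restricted
    to [t] in [C], the right one the law of [Z] restricted to [Y] in [C]. They agree on the
    half-lines by [level_itv]. *)
Let levelE B C : measurable B -> measurable C ->
  \int[P]_(t in C) lambda (xsection (V @^-1` B) t) =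
  mu (Y @^-1` C `&` (EFin \o Z) @^-1` B).
Proof.
move=> mB mC.
have mCT : measurable (C `*` [set: R]) by exact: measurableX.
have mYC : measurable (Y @^-1` C) by exact: measurable_preimage.
have mEZ : measurable_fun setT (EFin \o Z) by exact/measurable_EFinP.
pose PL : probability TR R := (P \x lambda).
have lawE B' : restricted_law PL mV mCT B' =
    \int[P]_(t in C) lambda (xsection (V @^-1` B') t).
  rewrite /restricted_law /PL /= /product_measure1 [RHS]integral_mkcond.
  apply: eq_integral => t _; rewrite patchE; case: ifPn => tC.
    congr (lambda _); apply/seteqP; split => u; rewrite /xsection/= !inE.
      by case.
    by move: tC; rewrite inE.
  rewrite /= (_ : xsection _ t = set0) ?measure0//.
  apply/seteqP; split => u //; rewrite /xsection/= inE => -[[/= Ct]].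
  by move: tC; rewrite notin_setE.
rewrite -lawE -[RHS]/(restricted_law mu mEZ mYC B).
apply: (finite_measure_unique (ErealGenInftyO.measurableE R)) => //.
- move=> _ _ [x ->] [y ->]; exists (Num.min x y).
  by apply/seteqP; split => z /=; rewrite !in_itv/= EFin_min lt_min;
    [move=> [-> ->]|move=> /andP[]].
- transitivity (mu (Y @^-1` C)); last by rewrite /= /restricted_law setIT.
  apply: (etrans (lawE _)); rewrite (eq_integral (cst 1)); last first.
    by move=> t _; rewrite xsectionE preimage_setT; exact: probability_setT.
  by rewrite integral_cst// mul1e.
by move=> _ [x ->]; apply: (etrans (lawE _)); rewrite level_itv.
Qed.

(** Inverse transform sampling: [k t] is the law of [W (t, u)] for [u] uniform on [0, 1]. It is thus
    a probability for every [t], even where the versions [f_] fail to be monotone. *)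
Lemma disintegration_ex : exists k : T -> probability R R,
  measurable_fun setT (k : T -> pprobability R R) /\
  forall B C, measurable B -> measurable C ->
    mu (Z @^-1` B `&` Y @^-1` C) =
    \int[probability_map mY mu]_(t in C) k t B.
Proof.
have kE t B : probability_map (mW1 t) lambda B = lambda (xsection (W @^-1` B) t).
  by rewrite xsectionE.
exists (fun t => probability_map (mW1 t) lambda); split.
  apply/measurable_pprobability => B mB; under eq_fun do rewrite kE.
  by apply: measurable_fun_xsection; exact: measurable_preimage.
move=> B C mB mC; under eq_integral do rewrite kE.
rewrite (_ : W @^-1` B = V @^-1` (fine @^-1` B))// levelE//.
  by rewrite setIC.
exact: measurable_preimage.
Qed.

End disintegration.

(** * The measurable space of sequences *)

Section sequence_space.
Context d (T : measurableType d).

Definition seq_box n (A : nat -> set T) : set (nat -> T) :=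
  [set x | forall i, (i < n)%N -> A i (x i)].

(** Boxes, rather than conditions on one coordinate, are taken as generators because they are closed
    under intersection. *)
Definition seq_boxes : set_system (nat -> T) :=
  [set B | exists n A, (forall i, measurable (A i)) /\ B = seq_box n A].

Definition seqs : measurableType seq_boxes.-sigma :=
  g_sigma_algebraType seq_boxes.

Lemma seq_boxesI : setI_closed seq_boxes.
Proof.
move=> _ _ [n [A [mA ->]]] [m [B [mB ->]]].
exists (maxn n m), (fun i => (if (i < n)%N then A i else setT) `&`
  (if (i < m)%N then B i else setT)); split => [i|].
  by apply: measurableI; case: ifP.
apply/seteqP; split => x /=.
  by move=> [Ax Bx] i _; split; case: ifP => // ?; [exact: Ax|exact: Bx].
by move=> h; split => i ni; have := h i; rewrite leq_max ni ?orbT => /(_ isT)[].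
Qed.

Lemma measurable_seq_box n A : (forall i, measurable (A i)) ->
  measurable (seq_box n A : set seqs).
Proof. by move=> mA; apply: sub_sigma_algebra; exists n, A. Qed.

Lemma measurable_coord i : measurable_fun setT (fun x : seqs => x i).
Proof.
move=> _ A mA; rewrite setTI.
rewrite (_ : _ @^-1` _ = seq_box i.+1 (fun j => if j == i then A else setT)).
  by apply: measurable_seq_box => j; case: ifP.
apply/seteqP; split => x /= Ax; first by move=> j _; case: eqP => // ->.
by have := Ax i (ltnSn i); rewrite eqxx.
Qed.

Lemma measurable_fun_seqs d' (S : measurableType d') (f : S -> seqs) :
  (forall i, measurable_fun setT (fun s => f s i)) -> measurable_fun setT f.
Proof.
move=> mf; apply: (@measurability _ _ _ seqs setT f seq_boxes erefl).
move=> _ [_ [n [A [mA ->]]] <-].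
rewrite setTI (_ : _ @^-1` _ = \bigcap_(i in `I_n) (fun s => f s i) @^-1` A i).
  apply: fin_bigcap_measurable => [|i _]; first exact: finite_II.
  exact: measurable_preimage.
by apply/seteqP; split => x h i ni; exact: h.
Qed.

Definition reindex (s : nat -> nat) (x : seqs) : seqs := fun i => x (s i).

Lemma measurable_reindex (s : nat -> nat) : measurable_fun setT (reindex s).
Proof. by apply: measurable_fun_seqs => i; exact: measurable_coord. Qed.

End sequence_space.

(** * Laws invariant under deletion of a coordinate *)

Section spreadable.
Local Open Scope ereal_scope.
Context d (T : measurableType d) (R : realType) (P : probability (seqs T) R).
Hypothesis spread : forall a C, measurable C ->
  P (reindex (bump a) @^-1` C) = P C.

(** [bump a] skips the value [a], so [reindex (bump a)] deletes coordinate [a]; for [a = 0] this is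
    the shift. *)
Let theta : seqs T -> seqs T := reindex (bump 0).

Let mtheta : measurable_fun setT theta.
Proof. exact: measurable_reindex. Qed.

Lemma integral_bump a (phi : seqs T -> \bar R) : measurable_fun setT phi ->
  (forall x, 0 <= phi x) -> \int[P]_x phi (reindex (bump a) x) = \int[P]_x phi x.
Proof.
move=> mphi phi0; under [RHS]eq_integral do rewrite -[phi _]mule1.
apply: (@ge0_integral_law_density _ _ _ _ _ _ _ (reindex (bump a)) _ (cst 1)) => //.
  exact: measurable_reindex.
by move=> C mC; rewrite setTI integral_cst// mul1e; exact: spread.
Qed.

Variable h : set T -> seqs T -> R.
Hypothesis mh : forall A, measurable A -> measurable_fun setT (h A).
Hypothesis h01 : forall A x, measurable A -> (0 <= h A x <= 1)%R.
(** The integral is against [P] because [theta x] has law [P] too. So [h A] at [theta x] is the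
    conditional probability of the head lying in [A]. *)
Hypothesis hE : forall A C, measurable A -> measurable C ->
  P ((fun x : seqs T => x 0%N) @^-1` A `&` theta @^-1` C) =
  \int[P]_(x in C) (h A x)%:E.

Let mhE A : measurable A -> measurable_fun setT (fun x => (h A x)%:E).
Proof. by move=> mA; apply/measurable_EFinP; exact: mh. Qed.

Let h_ge0 A x : measurable A -> 0 <= (h A x)%:E.
Proof. by move=> mA; rewrite lee_fin; have /andP[] := h01 x mA. Qed.

Let integral_head A (phi : seqs T -> \bar R) : measurable A ->
  measurable_fun setT phi -> (forall x, 0 <= phi x) ->
  \int[P]_(x in (fun x : seqs T => x 0%N) @^-1` A) phi (theta x) =
  \int[P]_x (phi x * (h A x)%:E).
Proof.
move=> mA mphi phi0; apply: ge0_integral_law_density => //.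
- apply: measurable_preimage mA; exact: measurable_coord.
- exact: mhE.
- by move=> x; exact: h_ge0.
- by move=> C mC; exact: hE.
Qed.

(* Apply the invariance under deletion of coordinate 1 to 1_A(x_0) phi(theta x):
   it fixes x_0 and turns theta x into theta (theta x). *)
Let integral_theta A (phi : seqs T -> \bar R) : measurable A ->
  measurable_fun setT phi -> (forall x, 0 <= phi x) ->
  \int[P]_x (phi (theta x) * (h A x)%:E) = \int[P]_x (phi x * (h A x)%:E).
Proof.
move=> mA mphi phi0.
have mhead : measurable ((fun x : seqs T => x 0%N) @^-1` A).
  by apply: measurable_preimage mA; exact: measurable_coord.
have mphit : measurable_fun setT (phi \o theta) by exact: measurableT_comp.
rewrite -!integral_head// integral_mkcond [RHS]integral_mkcond.
rewrite -[RHS](integral_bump 1); last 2 first.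
- by apply/(measurable_restrictT _ _).1 => //; exact: measurable_funTS.
- by apply: erestrict_ge0.
by apply: eq_integral => x _; rewrite !patchE.
Qed.

(* (h - h o theta)^2 integrates to 0, as h^2, (h o theta)^2 and h (h o theta)
   have the same finite integral. *)
Let h_theta A : measurable A -> {ae P, forall x, h A (theta x) = h A x}.
Proof.
move=> mA; set g := h A.
have mg : measurable_fun setT g by exact: mh.
have mgt : measurable_fun setT (g \o theta) by exact: measurableT_comp.
have mEFin (f : seqs T -> R) : measurable_fun setT f ->
    measurable_fun setT (fun x => (f x)%:E) by move=> mf; exact/measurable_EFinP.
have g0 x : (0 <= g x)%R by have /andP[] := h01 x mA.
have g1 x : (g x <= 1)%R by have /andP[] := h01 x mA.
have gg0 x y : 0 <= (g x * g y)%:E by rewrite lee_fin; apply: mulr_ge0.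
pose I := \int[P]_x (g x * g x)%:E.
have Ioo : I \is a fin_num.
  rewrite ge0_fin_numE; last by apply: integral_ge0.
  apply: (@le_lt_trans _ _ (\int[P]_x (cst 1 x))); last first.
    by rewrite integral_cst// mul1e -ge0_fin_numE// fin_num_measure.
  apply: ge0_le_integral => //.
  - by apply: mEFin; exact: measurable_funM.
  - by move=> x _; rewrite lee_fin mulr_ile1 ?g0 ?g1.
have I_cross : \int[P]_x (g (theta x) * g x)%:E = I.
  under eq_integral do rewrite EFinM.
  by rewrite (@integral_theta _ (EFin \o g))//; exact: mEFin.
have I_theta : \int[P]_x (g (theta x) * g (theta x))%:E = I.
  rewrite (integral_bump 0 (phi := fun x => (g x * g x)%:E))//.
  by apply: mEFin; exact: measurable_funM.
pose D x := ((g (theta x) - g x) ^+ 2)%R.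
have mD : measurable_fun setT D.
  by apply: measurable_funX; exact: measurable_funB.
have mcross : measurable_fun setT (fun x => (g (theta x) * g x)%:E).
  by apply: mEFin; exact: measurable_funM.
have mself : measurable_fun setT (fun x => (g x * g x)%:E).
  by apply: mEFin; exact: measurable_funM.
have mshift : measurable_fun setT (fun x => (g (theta x) * g (theta x))%:E).
  by apply: mEFin; exact: measurable_funM.
have D0 : \int[P]_x (D x)%:E = 0.
  (* The square is expanded with the cross terms moved to the left, so that all summands are
     nonnegative; the finite [I + I] is cancelled afterwards. *)
  have : (\int[P]_x (D x)%:E) + ((\int[P]_x (g (theta x) * g x)%:E) +
      (\int[P]_x (g (theta x) * g x)%:E)) =
      (\int[P]_x (g (theta x) * g (theta x))%:E) + I.
    rewrite -!ge0_integralD//=.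
    - by apply: eq_integral => x _; rewrite -!EFinD; congr EFin; rewrite /D; ring.
    - by move=> x _; rewrite lee_fin sqr_ge0.
    - exact: mEFin.
    - by move=> x _; rewrite adde_ge0.
    - exact: emeasurable_funD.
  have II : I + I \is a fin_num by rewrite fin_numD Ioo.
  by rewrite I_cross I_theta => DI; rewrite -[LHS](addeK _ II) DI subee.
have : ae_eq P setT (EFin \o D) (cst 0).
  apply/ae_eq_integral_abs => //; first exact: mEFin.
  rewrite -[RHS]D0; apply: eq_integral => x _; rewrite gee0_abs// lee_fin sqr_ge0//.
by apply: filterS => x /= /(_ Logic.I) [] /eqP; rewrite sqrf_eq0 subr_eq0 => /eqP.
Qed.

(** The weight [psi] serves the induction: peeling off the head multiplies it by [h (A 0)], and by
    [h_theta] the product is again shift-invariant almost everywhere. *)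
Let integral_seq_box n A (psi : seqs T -> \bar R) :
  (forall i, measurable (A i)) -> measurable_fun setT psi ->
  (forall x, 0 <= psi x) -> {ae P, forall x, psi (theta x) = psi x} ->
  \int[P]_(x in seq_box n A) psi x =
  \int[P]_x (psi x * \prod_(i < n) (h (A i) x)%:E).
Proof.
elim: n A psi => [|n IH] A psi mA mpsi psi0 psit.
  rewrite (_ : seq_box _ _ = setT); last by apply/seteqP.
  by apply: eq_integral => x _; rewrite big_ord0 mule1.
pose A' i := A i.+1.
have mA' i : measurable (A' i) by exact: mA.
have mbox : measurable (seq_box n A' : set (seqs T)) by exact: measurable_seq_box.
have boxE : seq_box n.+1 A =
    (fun x : seqs T => x 0%N) @^-1` (A 0%N) `&` theta @^-1` (seq_box n A').
  apply/seteqP; split => [x Ax|x [/= A0 Ax] [|i]//].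
    by split => [|i ni]; exact: Ax.
  by rewrite ltnS; exact: Ax.
have mhead : measurable ((fun x : seqs T => x 0%N) @^-1` A 0%N).
  by apply: measurable_preimage (mA 0%N); exact: measurable_coord.
have mpsit : measurable_fun setT (psi \o theta) by exact: measurableT_comp.
pose psiB x := psi x * (\1_(seq_box n A' : set (seqs T)) x)%:E.
have mpsiB : measurable_fun setT psiB.
  by apply: emeasurable_funM => //; apply/measurable_EFinP.
have psiB0 x : 0 <= psiB x by rewrite mule_ge0.
(* With [psi] taken at [theta x], everything but the condition on the head depends on [theta x]
   only, and [integral_head] trades that condition for [h (A 0)]. *)
transitivity (\int[P]_(x in seq_box n.+1 A) psi (theta x)).
  apply: ge0_ae_eq_integral => //.
  - exact: measurable_seq_box.
  - exact: measurable_funTS.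
  - exact: measurable_funTS.
  - by apply: filterS psit => x -> _.
rewrite boxE integral_mkcondr (eq_integral (psiB \o theta)); last first.
  move=> x _; rewrite patchE /psiB /= indicE.
  have -> : (x \in theta @^-1` seq_box n A') = (theta x \in seq_box n A').
    by apply/idP/idP; rewrite !inE.
  by case: ifP; rewrite ?mule1 ?mule0.
rewrite integral_head//.
transitivity (\int[P]_(x in seq_box n A') (psi x * (h (A 0%N) x)%:E)).
  rewrite [RHS]integral_mkcond; apply: eq_integral => x _.
  by rewrite patchE /psiB indicE; case: ifP; rewrite ?mule1 ?mule0 ?mul0e.
rewrite IH//.
- by apply: eq_integral => x _; rewrite big_ord_recl muleA.
- by apply: emeasurable_funM => //; exact: mhE.
- by move=> x; rewrite mule_ge0// h_ge0.
- by apply: filterS2 psit (h_theta (mA 0%N)) => x -> ->.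
Qed.

Lemma spreadable_seq_box n A : (forall i, measurable (A i)) ->
  P (seq_box n A) = \int[P]_x (\prod_(i < n) (h (A i) x)%:E).
Proof.
move=> mA; have mbox := measurable_seq_box n mA.
rewrite -[LHS]mul1e -integral_cst// integral_seq_box//=.
  by apply: eq_integral => x _; rewrite mul1e.
exact: aeW.
Qed.

End spreadable.

(** * From exchangeability to mixtures of product laws *)

Lemma bump_extension a n : exists s : nat -> nat,
  bijective s /\ forall i, (i < n)%N -> s i = bump a i.
Proof.
pose m := maxn a n.
have am : (a <= m)%N by exact: leq_maxl.
have nm : (n <= m)%N by exact: leq_maxr.
(* Below [m], [bump a] takes every value up to [m] except [a]. Sending [m] to [a] and fixing all
   larger numbers completes it to a permutation. *)
exists (fun i => if i == m then a else if (i < m)%N then bump a i else i).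
split; last by move=> i ni; rewrite (leq_trans ni nm) ltn_eqF// (leq_trans ni nm).
exists (fun j => if j == a then m else if (j <= m)%N then unbump a j else j).
  move=> i; rewrite /bump /unbump; repeat case: ifP; lia.
move=> i; rewrite /bump /unbump; repeat case: ifP; lia.
Qed.

(** A box constrains finitely many coordinates, on which a deletion agrees with a permutation, and
    boxes determine the law. *)
Lemma exchangeable_spreadable d (T : measurableType d) (R : realType)
    (P : probability (seqs T) R) :
  (forall s n A, bijective s -> (forall i, measurable (A i)) ->
    P (reindex s @^-1` seq_box n A) = P (seq_box n A)) ->
  forall a C, measurable C -> P (reindex (bump a) @^-1` C) = P C.
Proof.
move=> exch a C mC.
pose Q : probability (seqs T) R := probability_map (measurable_reindex (bump a)) P.
have := @finite_measure_unique _ (seqs T) R (@seq_boxes _ T) Q P erefl.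
apply => //.
- exact: seq_boxesI.
move=> _ [n [A [mA ->]]]; have [s [bs sE]] := bump_extension a n.
have E : reindex (bump a) @^-1` seq_box n A = reindex s @^-1` seq_box n A.
  by apply/seteqP; split => x Ax i ni; have := Ax i ni; rewrite /reindex sE.
exact: (etrans (congr1 P E) (exch s n A bs mA)).
Qed.

(** What is disintegrated given the shifted sequence is the sample point in [R], not its image in
    the arbitrary space [T]: conditional laws exist on the real line, and [alpha] at coordinate 0
    carries them to [T]. *)
Lemma spreadable_mixture d (T : measurableType d) (R : realType)
    (mu : probability R R) (alpha : R -> seqs T)
    (malpha : measurable_fun setT alpha) :
  (forall a C, measurable C ->
    mu (alpha @^-1` (reindex (bump a) @^-1` C)) = mu (alpha @^-1` C)) ->
  exists g : R -> probability R R,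
    measurable_fun setT (g : R -> pprobability R R) /\
    forall n A, (forall i, measurable (A i)) ->
      mu (alpha @^-1` seq_box n A) =
      (\int[mu]_r \prod_(i < n) g r ((fun s => alpha s 0%N) @^-1` A i))%E.
Proof.
move=> spread; pose P : probability (seqs T) R := probability_map malpha mu.
have malpha0 : measurable_fun setT (fun s => alpha s 0%N).
  exact: (measurableT_comp (@measurable_coord _ T 0) malpha).
have mY : measurable_fun setT (reindex (bump 0) \o alpha).
  exact: (measurableT_comp (measurable_reindex (bump 0)) malpha).
have [k [mk kE]] := disintegration_ex mu mY (@measurable_id _ R setT).
pose B A := (fun s => alpha s 0%N) @^-1` A.
have mB A : measurable A -> measurable (B A) by exact: measurable_preimage.
have mkB A : measurable A -> measurable_fun setT (fun x => k x (B A)).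
  by move=> mA; have /measurable_pprobability := mk; apply; exact: mB.
have kfin x A : measurable A -> k x (B A) \is a fin_num.
  by move=> mA; apply: fin_num_measure; exact: mB.
exists (k \o alpha); split; first exact: measurableT_comp.
move=> n A mA.
have := @spreadable_seq_box _ T R P spread (fun A x => fine (k x (B A))).
move=> /(_ _ _ _ n A mA) PE.
transitivity (P (seq_box n A)) => //; rewrite PE.
- have fineE x : (\prod_(i < n) (fine (k x (B (A i))))%:E =
      \prod_(i < n) k x (B (A i)))%E.
    by apply: eq_bigr => i _; rewrite fineK// kfin.
  apply: (etrans (@ge0_integral_pushforward _ _ _ _ _ _ malpha mu setT
    _ _ _ _)) => //.
  + under eq_fun do rewrite prodEFin.
    apply/measurable_EFinP; apply: measurable_prod => i _.
    by apply: measurableT_comp; [exact: fine_measurable|exact: mkB].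
  + by move=> x _; rewrite fineE; apply: prode_ge0 => i _; exact: measure_ge0.
  + by apply: eq_integral => r _; rewrite /= fineE.
- move=> A' mA'; apply: measurableT_comp; first exact: fine_measurable.
  exact: mkB.
- move=> A' x mA'; rewrite fine_ge0//= -lee_fin fineK ?kfin//.
  by apply: probability_le1; exact: mB.
move=> A' C mA' mC; under eq_integral do rewrite fineK ?kfin//.
rewrite -[LHS]/(mu (B A' `&` (reindex (bump 0) \o alpha) @^-1` C)).
(* [kE] integrates against the law of the shifted sequence, which equals [P] by [spread]. *)
rewrite (kE _ _ (mB _ mA') mC); apply: eq_measure_integral => D mD _.
exact: spread.
Qed.

(** * Uniqueness on the product sigma-algebra of a power *)

Section pow_sigma.
Context {R : realType} (X : qbs R) (n : nat).

Let boxes : set_system (qbs_pow X n) :=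
  [set B | exists A : 'I_n -> set X,
    (forall i, qbs_sigma (A i)) /\ B = [set x | forall i, A i (x i)]].

Let boxesI : setI_closed boxes.
Proof.
move=> _ _ [A [mA ->]] [B [mB ->]]; exists (fun i => A i `&` B i); split.
  by move=> i a ha; rewrite preimage_setI; apply: measurableI; [exact: mA|exact: mB].
apply/seteqP; split => x /=; first by move=> [Ax Bx] i; split.
by move=> h; split => i; case: (h i).
Qed.

(** A pi-lambda argument on boxes. Since [prob_meas] behaves as a measure only on [qbs_sigma],
    membership there is carried along in [E]. *)
Lemma pow_sigma_unique (u v : qbs_prob (qbs_pow X n)) :
  (forall A : 'I_n -> set X, (forall i, qbs_sigma (A i)) ->
    prob_meas u [set x | forall i, A i (x i)] =
    prob_meas v [set x | forall i, A i (x i)]) ->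
  forall U, pow_sigma X n U -> prob_meas u U = prob_meas v U.
Proof.
move=> uv U mU.
have [sT sC sU] := qbs_sigma_algebra (qbs_pow X n).
pose E := [set V : set (qbs_pow X n) | qbs_sigma V /\ prob_meas u V = prob_meas v V].
suff: <<d boxes >> `<=` E.
  rewrite setI_closed_g_dynkin_g_sigma_algebra// => sE; apply: (proj2 (sE U _)).
  apply: smallest_sub mU; first exact: smallest_sigma_algebra.
  move=> _ [i _ [A mA <-]]; rewrite setTI; apply: sub_sigma_algebra.
  exists (fun j => if j == i then A else setT); split.
    move=> j; case: ifP => // _ a _; rewrite preimage_setT; exact: measurableT.
  apply/seteqP; split => x /=; first by move=> Ax j; case: eqP => // ->.
  by move=> /(_ i); rewrite eqxx.
apply: smallest_sub.
  split.
  - split; first by move=> a _; rewrite preimage_setT.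
    by rewrite /prob_meas !preimage_setT !probability_setT.
  - move=> V [mV VE]; split; first by rewrite -setTD; exact: sC.
    rewrite /prob_meas -!preimage_setC !probability_setC.
    + by congr (_ - _)%E.
    + by apply: mV; exact: prob_rvP.
    + by apply: mV; exact: prob_rvP.
  - move=> F tF FE; split; first by apply: sU => i; case: (FE i).
    have tFp (w : qbs_prob (qbs_pow X n)) :
        trivIset setT (fun i => prob_rv w @^-1` F i).
      by move=> i j _ _ [r [Fi Fj]]; apply: tF => //; exists (prob_rv w r).
    rewrite /prob_meas !preimage_bigcup !measure_bigcup//.
    + by apply: eq_eseriesr => i _; case: (FE i).
    + by move=> i _; have [mF _] := FE i; apply: mF; exact: prob_rvP.
    + by move=> i _; have [mF _] := FE i; apply: mF; exact: prob_rvP.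
move=> _ [A [mA ->]]; split; last exact: uv.
move=> a ha.
rewrite (_ : _ @^-1` _ = \bigcap_(i in [set: 'I_n]) (a^~ i @^-1` A i)); last first.
  by apply/seteqP; split => r h i; [move=> _; exact: h|exact: h].
by apply: fin_bigcap_measurable => // i _; exact: (mA i (a^~ i) (ha i)).
Qed.

End pow_sigma.

(** * Transfer to quasi-Borel spaces *)

Lemma exchangeable_qbs_mixture (R : realType) (X : qbs R)
    (p : qbs_prob (qbs_omega X)) : exchangeable p ->
  exists g : R -> probability R R,
    measurable_fun setT (g : R -> pprobability R R) /\
    forall n (A : nat -> set X), (forall i, qbs_sigma (A i)) ->
      prob_meas p [set x | forall i, (i < n)%N -> A i (x i)] =
      (\int[prob_law p]_r
        \prod_(i < n) g r ((fun s => prob_rv p s 0%N) @^-1` A i))%E.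
Proof.
move=> exch.
(* A value of the random element supplies the point that [pointedType] asks for. *)
pose x0 : X := prob_rv p 0 0%N.
pose pX : pointedType :=
  HB.pack (qbs_sort X) (gen_eqMixin X) (gen_choiceMixin X) (isPointed.Build X x0).
pose T : measurableType _ := g_sigma_algebraType (@qbs_sigma R X : set_system pX).
have mT (A : set X) : @measurable _ T A = qbs_sigma A.
  by rewrite /measurable/= sigma_algebra_id//; exact: qbs_sigma_algebra.
pose alpha : R -> seqs T := prob_rv p.
have malpha : measurable_fun setT alpha.
  apply: measurable_fun_seqs => i _ A mA; rewrite setTI.
  have : qbs_sigma A by rewrite -mT.
  by apply; exact: (prob_rvP p).
pose P : probability (seqs T) R := probability_map malpha (prob_law p).
have spread : forall a C, measurable C -> P (reindex (bump a) @^-1` C) = P C.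
  apply: exchangeable_spreadable => s n A bs mA.
  (* Equality of classes gives equality only on [qbs_sigma] of the sequence space; a box lies there
     as a finite intersection of coordinate conditions. *)
  have /prob_classP/(_ (seq_box n A)) E := exch s bs; apply/esym/E => a ha.
  rewrite (_ : _ @^-1` _ = \bigcap_(i in `I_n) ((fun r => a r i) @^-1` A i)).
    apply: fin_bigcap_measurable => [|i _]; first exact: finite_II.
    by have := mA i; rewrite mT; apply; exact: ha.
  by apply/seteqP; split => r h i ni; exact: h.
have [g [mg gE]] := spreadable_mixture malpha spread.
exists g; split => // n A mA; apply: gE => i; rewrite mT; exact: mA.
Qed.

Theorem theorem29 (R : realType) (X : qbs R) (p : qbs_prob (qbs_omega X))
    (p_exchangeable : exchangeable p) :
  exists q : qbs_prob (prob_qbs X),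
    forall (n : nat) (n_gt0 : (0 < n)%N) (U : set (qbs_pow X n)),
      pow_sigma X n U ->
      class_meas (class_bind (prob_class q) (iid X n_gt0)) U =
      class_meas (class_map (qbs_prefix X n) (prob_class p)) U.
Proof.
have [g [mg gE]] := exchangeable_qbs_mixture p_exchangeable.
pose alpha0 r : X := prob_rv p r 0%N.
have halpha0 : qbs_rv X alpha0 by exact: (prob_rvP p).
pose b r : prob_qbs X := prob_class (QbsProb halpha0 (g r)).
have hb : qbs_rv (prob_qbs X) b by exists alpha0, halpha0, g.
exists (QbsProb hb (prob_law p)) => n n_gt0 U mU.
pose iota := tuple_iso R n_gt0.
pose gn r : probability R R := probability_map (iso_from_measurable iota)
  (iid_probability (g r) n).
have mgn : measurable_fun setT (gn : R -> pprobability R R).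
  apply/measurable_pprobability => V mV.
  have /measurable_pprobability := measurable_iid_probability (n := n) mg; apply.
  exact: measurable_preimage (iso_from_measurable iota) mV.
(* Along [b] the values of [iid] have explicit representatives with one common random element and
   the measurable kernel [gn], so the bind can be computed from them. *)
have bindE : class_bind (prob_class (QbsProb hb (prob_law p))) (iid X n_gt0) =
    prob_class (QbsProb (iid_rvP n_gt0 halpha0) (probability_bind (prob_law p) mgn)).
  apply: class_bindP.
  exists (QbsProb hb (prob_law p)), _, (iid_rvP n_gt0 halpha0), gn, mgn.
  by split => // r; exact: class_iidE.
have mU' := pow_sigma_sub mU.
rewrite bindE class_mapE !class_measE//.
apply: pow_sigma_unique mU => A mA.
(* The mixture formula takes sides indexed by all naturals; sides beyond [n] are full. *)
pose A' k := if insub k is Some i then A (i : 'I_n) else setT.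
have mA' k : qbs_sigma (A' k).
  by rewrite /A'; case: insub => // a _; rewrite preimage_setT.
have A'E (i : 'I_n) : A' i = A i by rewrite /A' valK.
transitivity (prob_meas p [set x | forall i, (i < n)%N -> A' i (x i)]); last first.
  congr (prob_law p _); apply/seteqP; split => r /= Ar i.
    by rewrite -A'E; exact: Ar.
  by move=> ni; have := Ar (Ordinal ni); rewrite -A'E.
rewrite gE//; apply: eq_integral => r _.
under [RHS]eq_bigr do rewrite A'E.
(* The integrand is the mass of a box under the n-fold product of [g r], which [gn r] transports to
   [R] along [iota]. *)
rewrite -iid_probability_box; last by move=> i; exact: mA.
rewrite /gn /= /distribution /pushforward; congr (_ _).
by apply/seteqP; split => t /= At i; have := At i; rewrite iso_fromK.
Qed.
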